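(* Let $\mathbb{F}_q$ be the finite field with $q$ elements. For every fixed $\varepsilon>0$ there exists $\delta>0$ such that the following holds. Let $\lambda\in\mathbb{F}_q^*$ and let $\mathcal{A},\mathcal{B},\mathcal{C},\mathcal{D}\subseteq\mathbb{F}_q$ be sets with $$\#\mathcal{A}\ge q^{1/2+\varepsilon},\qquad \#\mathcal{B}\ge q^{\varepsilon},\qquad \#\mathcal{C}\,\#\mathcal{D}\ge q^{2-\delta}.$$ Let $N(\mathcal{A},\mathcal{B},\mathcal{C},\mathcal{D};\lambda)$ be the number of solutions of $$ab+cd=\lambda,\qquad a\in\mathcal{A},\ b\in\mathcal{B},\ c\in\mathcal{C},\ d\in\mathcal{D},$$ and let $T(\mathcal{A},\mathcal{B},\mathcal{C},\mathcal{D})$ be the number of solutions of $$a+b=cd,\qquad a\in\mathcal{A},\ b\in\mathcal{B},\ c\in\mathcal{C},\ d\in\mathcal{D}.$$ Then $$N(\mathcal{A},\mathcal{B},\mathcal{C},\mathcal{D};\lambda)=\frac{\#\mathcal{A}\,\#\mathcal{B}\,\#\mathcal{C}\,\#\mathcal{D}}{q}\left(1+O(q^{-\delta})\right)$$ and $$T(\mathcal{A},\mathcal{B},\mathcal{C},\mathcal{D})=\frac{\#\mathcal{A}\,\#\mathcal{B}\,\#\mathcal{C}\,\#\mathcal{D}}{q}\left(1+O(q^{-\delta})\right),$$ where the implied constants depend only on $\varepsilon$ (in particular, not on $q$, $\lambda$, or the sets).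
   Context: $\#\mathcal{S}$ denotes the cardinality of a set $\mathcal{S}$, and $\mathbb{F}_q^*=\mathbb{F}_q\setminus\{0\}$. Solutions are counted as quadruples $(a,b,c,d)$. *)

(* Defs.v *)
From HB Require Import structures.
From mathcomp Require Import all_boot all_order all_algebra.
From mathcomp Require Import reals exp.

Set Implicit Arguments.
Unset Strict Implicit.
Unset Printing Implicit Defensive.

Import Order.TTheory GRing.Theory Num.Theory.
Local Open Scope ring_scope.

Definition countN (F : finFieldType) (A B C D : {set F}) (lambda : F) : nat :=
  #|[set x : F * F * F * F | let: (a, b, c, d) := x in
      [&& a \in A, b \in B, c \in C, d \in D & a * b + c * d == lambda]]|.

Definition countT (F : finFieldType) (A B C D : {set F}) : nat :=
  #|[set x : F * F * F * F | let: (a, b, c, d) := x in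
      [&& a \in A, b \in B, c \in C, d \in D & a + b == c * d]]|.

(* Main.v *)
Require Import Defs.
From HB Require Import structures.
From mathcomp Require Import all_boot all_order all_algebra.
From mathcomp Require Import all_fingroup all_solvable all_field all_character.
From mathcomp Require Import zify ring lra.
From mathcomp Require Import reals exp.

Set Implicit Arguments.
Unset Strict Implicit.
Unset Printing Implicit Defensive.

Import Order.TTheory GRing.Theory Num.Theory.
Local Open Scope ring_scope.

(** Karatsuba's argument.  For a nontrivial multiplicative character [chi] of the
    field with [q] elements and [z x = sum_(b in B) w b * chi (x + b)], Hoelder's
    inequality bounds [|sum_(a in A) z a|^(2k)] by [|A|^(2k-1) * sum_x |z x|^(2k)].
    Expanding the power, a [2k]-tuple of shifts contributes [O(sqrt q)] by Weil's
    bound as soon as one shift occurs exactly once, and the other tuples are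
    few.  With [|A| >= q^(1/2+epsilon)] and [|B|^k >= q^(1/2)] this saves a power of
    [q] over the trivial bound.  Detecting [a + b = mu b * (c * d)] by characters
    and applying Parseval to the sums over [c] and [d], which costs only
    [q / sqrt (|C| |D|)], gives both asymptotic formulas.

    Weil's bound is obtained by Stepanov's method over the extensions of even
    degree [2n] of the field, whose order is the square of [r = q^n]: raising to
    the power [r] is additive, and applying it twice fixes every element.  The
    resulting bound has a constant depending on [q], which disappears in the
    limit in [n]: these sums are the power sums of the inverse roots of the
    L-function of the character sum, which is a polynomial; so every inverse
    root has modulus at most [sqrt q]. *)

(** * Stepanov's method *)

(** A shift that occurs exactly once serves twice in Weil's bound. It gives the polynomial of
    Stepanov's method a simple zero, and it allows the value of a polynomial to be changed at one
    point only, which is why the L-function is a polynomial. The other shifts may coincide and carry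
    any multiplicity; this freedom is needed because the complex conjugate of [chi y] is
    [chi (y ^+ (q - 2))].

    Stepanov's method bounds the fibres of the norm only from above. Together with the few zeros of
    [f] the fibres fill the extension, so their total defect is small; as [chi] sums to 0, the
    defects alone determine the character sum, and no lower bound for a single fibre is required.

    Character values lie in [algC], whereas the theorem speaks of a [realType]. The estimate passes
    from one to the other as an inequality between natural numbers; this is why it is stated for the
    [4 * k]-th power of the error, where no root is left. *)

Lemma exists_polynomial_relation (E : fieldType) (T : finType) (n : nat)
    (P : T -> {poly E}) :
  (forall t, size (P t) <= n)%N -> (n < #|T|)%N ->
  exists2 v : T -> E, (exists t, v t != 0) & \sum_t v t *: P t = 0.
Proof.
move=> sizeP lt_n_T.
pose M := \matrix_(i < #|T|, j < n) (P (enum_val i))`_j.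
have: kermx M != 0.
  rewrite -mxrank_eq0 mxrank_ker subn_eq0 -ltnNge.
  exact: leq_ltn_trans (rank_leq_col M) lt_n_T.
case/rowV0Pn => u /sub_kermxP uM0 u_neq0.
exists (fun t => u 0 (enum_rank t)).
  have [i ui] : exists i, u 0 i != 0.
    apply/existsP; rewrite -negb_forall; apply: contra u_neq0 => /forallP u0.
    by apply/eqP/rowP => i; rewrite mxE; apply/eqP.
  by exists (enum_val i); rewrite enum_valK.
apply/polyP => k; rewrite coef0 coef_sum.
have [lt_kn|le_nk] := ltnP k n; last first.
  apply: big1 => t _; rewrite coefZ nth_default ?mulr0 //.
  exact: leq_trans (sizeP t) le_nk.
have := congr1 (fun A : 'rV_n => A 0 (Ordinal lt_kn)) uM0.
rewrite !mxE (reindex_onto enum_rank enum_val) /=; last first.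
  by move=> i _; rewrite enum_valK.
move=> uMk0; rewrite -[RHS]uMk0; under [RHS]eq_bigl do rewrite enum_rankK eqxx.
by apply: eq_bigr => t _; rewrite coefZ !mxE enum_rankK.
Qed.

(* Multiplying [phi ^+ r] by [f ^+ ((d - 1) * e)] turns it, on the set where
   [f ^+ ((r + 1) * e)] is [c], into a polynomial of much lower degree, which is
   made zero by linear algebra.  The terms of [phi] vanish at 0 to pairwise
   distinct orders because 0 is a simple zero of [f]; so [phi] is not zero. *)
Lemma stepanov_bound (E : finFieldType) (p r d e m : nat) (f g : {poly E})
    (c : E) :
  p \in [pchar E] -> p.-nat r -> #|E| = (r ^ 2)%N -> r = (d * e).+1 ->
  (4 < r)%N -> f = 'X * g -> g.[0] != 0 -> (size f <= m.+1)%N -> c != 0 ->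
  (#|[set x | f.[x] ^+ (r.+1 * e) == c]| <= e * r + (3 * m + 1) * r)%N.
Proof.
move=> charE r_pnat cardE rE r_gt4 fE g0 size_f c0.
have [e0|e_gt0] := posnP e; first by rewrite rE e0 muln0 in r_gt4.
have [d0|d_gt0] := posnP d; first by rewrite rE d0 in r_gt4.
have frobS I (s : seq I) (F : I -> E) :
    (\sum_(i <- s) F i) ^+ r = \sum_(i <- s) F i ^+ r.
  elim/big_rec2: _ => [|i x y _ <-]; first by rewrite expr0n; case: (r) r_gt4.
  by rewrite exprDn_pchar // (eq_pnat _ (pcharf_eq charE)).
have frobK (x : E) : (x ^+ r) ^+ r = x by rewrite -exprM -[RHS]expf_card cardE.
have m_gt0 : (0 < m)%N.
  have g_neq0 : g != 0 by apply: contraNneq g0 => ->; rewrite horner0.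
  rewrite fE size_mul ?polyX_eq0 // size_polyX /= in size_f.
  by move: size_f; rewrite -size_poly_gt0 in g_neq0; move: g_neq0; case: (size g) => //= n _; lia.
(* As [d * e = r.-1], there are [I * r.-1] unknowns for fewer than about [r * (e + m)] coefficients;
   this width gives more unknowns than coefficients once [4 < r]. *)
pose I := (e + 2 * m).+1.
pose T : finType := ('I_I * 'I_d * 'I_e)%type.
have [u [t0 ut0] psi0] : exists2 u : T -> E, (exists t, u t != 0) &
    \sum_t (u t ^+ r * c ^+ t.1.2) *:
       ('X^(r * t.2 + t.1.1) * f ^+ ((d.-1 - t.1.2) * e)) = 0.
  have [||v [t vt] v0] := @exists_polynomial_relation E T (r * e.-1 + I + d.-1 * e * m)%N
    (fun t => c ^+ t.1.2 *: ('X^(r * t.2 + t.1.1) * f ^+ ((d.-1 - t.1.2) * e))).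
  - move=> [[i j] k] /=; apply: leq_trans (size_scale_leq _ _) _.
    apply: leq_trans (size_polyMleq _ _) _; rewrite size_polyXn /=.
    have size_fX := size_poly_exp_leq f ((d.-1 - j) * e).
    have le1 : ((size f).-1 * ((d.-1 - j) * e) <= d.-1 * e * m)%N.
      rewrite mulnC; apply: leq_mul; last by lia.
      by rewrite leq_mul2r leq_subr orbT.
    have le2 : (r * k <= r * e.-1)%N.
      by rewrite leq_mul2l; apply/orP; right; have := ltn_ord k; lia.
    have := leq_ltn_trans le1 (ltnSn _); move/(leq_trans size_fX).
    have := ltn_ord i; move: {i} (nat_of_ord i) => i.
    move: le2; move: (d.-1 * e * m)%N (r * k)%N (r * e.-1)%N (size (f ^+ _)).
    move: I {T} i => I' i a1 a2 a3 a4; lia.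
  - rewrite !card_prod !card_ord.
    have -> : (I * d * e = I * r.-1)%N by rewrite rE /= mulnA.
    have : (d.-1 * e * m <= r.-1 * m)%N by rewrite leq_mul // rE /= leq_mul // leq_pred.
    have : (e <= r.-1)%N by rewrite rE /= leq_pmull.
    by rewrite /I; nia.
  (* Raising to the power [r] is an involution of [E], so the solution [v] is the [r]-th power of
     [u]. *)
  exists (fun t => v t ^+ r); first by exists t; rewrite expf_neq0.
  by rewrite -[RHS]v0; apply: eq_bigr => s _; rewrite frobK scalerA.
pose phi := \sum_t u t *: ('X^(t.2 + t.1.1 * r) * f ^+ (t.1.2 * e)).
have phi_neq0 : phi != 0.
  pose nu (t : T) := (t.2 + t.1.1 * r + t.1.2 * e)%N.
  have nu_inj : injective nu.
    move=> [[i j] k] [[i' j'] k']; rewrite /nu /= => eq_nu.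
    (* The orders are numbers in mixed radix: [k] and [j] are the digits below [r], and [i] is the
       quotient by [r]. *)
    have modk (j1 : 'I_d) (k1 : 'I_e) : (k1 + j1 * e < r)%N.
      have : (j1.+1 * e <= d * e)%N by rewrite leq_mul2r ltn_ord orbT.
      by have := ltn_ord k1; rewrite rE mulSn; lia.
    have eq1 : (k + j * e + i * r = k' + j' * e + i' * r)%N by lia.
    have divmod_inj s a b a' b' : (b < s -> b' < s -> b + a * s = b' + a' * s ->
        a = a' /\ b = b')%N.
      move=> lt_b lt_b'; rewrite addnC [RHS]addnC => /(congr1 (edivn^~ s)).
      by rewrite !edivn_eq // => -[].
    have [eqi eq2] := divmod_inj _ _ _ _ _ (modk j k) (modk j' k') eq1.
    have [eqj eqk] := divmod_inj _ _ _ _ _ (ltn_ord k) (ltn_ord k') eq2.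
    by congr (_, _, _); apply: val_inj.
  pose t1 := [arg min_(t < t0 | u t != 0) nu t].
  have [ut1 min_t1] : u t1 != 0 /\ forall t, u t != 0 -> (nu t1 <= nu t)%N.
    by rewrite /t1; case: arg_minnP.
  apply/eqP => /(congr1 (fun q : {poly E} => q`_(nu t1))).
  rewrite coef0 coef_sum (bigD1 t1) //= big1 => [|t ne_t]; last first.
    have [->|ut] := eqVneq (u t) 0; first by rewrite scale0r coef0.
    rewrite fE exprMn mulrA -exprD coefZ coefXnM.
    case: ltnP; rewrite ?mulr0 // => le_nu.
    have := min_t1 t ut; rewrite leq_eqVlt => /orP[/eqP/nu_inj eqt|].
      by rewrite eqt eqxx in ne_t.
    by rewrite ltnNge le_nu.
  rewrite addr0 fE exprMn mulrA -exprD coefZ coefXnM ltnn subnn -horner_coef0.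
  by rewrite horner_exp => /eqP; rewrite mulf_eq0 (negPf ut1) expf_eq0 (negPf g0) andbF.
have phi_root x : x \in [set x | f.[x] ^+ (r.+1 * e) == c] -> root phi x.
  rewrite inE => /eqP fxc.
  have fx0 : f.[x] != 0 by apply: contra_neq c0 => fx0; rewrite -fxc fx0 expr0n muln_eq0 /= gtn_eqF.
  have : phi.[x] ^+ r * f.[x] ^+ (d.-1 * e) = 0.
    rewrite -[RHS](horner0 x) -[in RHS]psi0 /phi !horner_sum frobS mulr_suml.
    apply: eq_bigr => -[[i j] k] _ /=; rewrite !hornerE /=.
    have xE : x ^+ (k + i * r) ^+ r = x ^+ (r * k + i).
      rewrite [RHS]exprD -[X in _ = _ * X ^+ i]frobK -!exprM -exprD.
      by congr (_ ^+ _); ring.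
    (* The exponent is [j * (r.+1 * e) + (d.-1 - j) * e]; the extra factor [f ^+ (d.-1 * e)] keeps
       its second part nonnegative for every [j < d]. *)
    have feE : f.[x] ^+ (j * e) ^+ r * f.[x] ^+ (d.-1 * e) =
               c ^+ j * f.[x] ^+ ((d.-1 - j) * e).
      rewrite -fxc -!exprM -!exprD; congr (_ ^+ _).
      have : (j + (d.-1 - j) = d.-1)%N by rewrite subnKC // -ltnS prednK.
      by move: (d.-1 - j)%N => w <-; nia.
    by rewrite !exprMn xE -!mulrA feE; ring.
  move/eqP; rewrite mulf_eq0 !expf_eq0 (negPf fx0) andbF orbF => /andP[_].
  by rewrite rootE.
pose Z := [set x | f.[x] ^+ (r.+1 * e) == c].
have : (#|Z| < size phi)%N.
  rewrite fintype.cardE; apply: max_poly_roots phi_neq0 _ (enum_uniq _).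
  by apply/allP => x; rewrite mem_enum => /phi_root.
(* The leading term [e * r], about [r ^ 2 / d], is the expected size of [Z], since the power in
   question takes at most [d] nonzero values. *)
rewrite -/Z; suff : (size phi <= e * r + (3 * m + 1) * r)%N by lia.
apply: leq_trans (size_sum _ _ _) _; apply/bigmax_leqP => -[[i j] k] _ /=.
apply: leq_trans (size_scale_leq _ _) _.
apply: leq_trans (size_polyMleq _ _) _; rewrite size_polyXn /=.
have size_fX := size_poly_exp_leq f (j * e).
have le1 : ((size f).-1 * (j * e) <= m * r)%N.
  apply: leq_mul; first by lia.
  by rewrite rE ltnW // ltnS leq_mul2r ltnW ?ltn_ord ?orbT.
have le2 : (i * r <= (e + 2 * m) * r)%N by rewrite leq_mul2r -ltnS ltn_ord orbT.
have le3 := ltn_ord k.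
have le4 : (e <= r.-1)%N by rewrite rE /= leq_pmull.
move: le2 le3 (leq_trans size_fX (leq_ltn_trans le1 (ltnSn _))).
move: (size (f ^+ _)) (i * r)%N => a1 a2 le2 le3 le5.
have : (a2 + k + a1 <= (e + 2 * m) * r + e + m * r)%N; by lia.
Qed.

(** * Monic polynomials and L-functions *)

Section MonicPolynomials.

Variable F : finFieldType.
Implicit Types (P Q h : {poly F}) (n s : nat).

Definition monics n : seq {poly F} := [seq 'X^n + val p | p : {poly_n F}].

Definition irreducibles n : seq {poly F} := [seq P <- monics n | irreducibleb P].

Lemma mem_monics n h : (h \in monics n) = (h \is monic) && (size h == n.+1).
Proof.
apply/mapP/andP => [[p _ ->]|[mon_h /eqP size_h]].
  have szp : (size (val p) < size ('X^n : {poly F}))%N.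
    by rewrite size_polyXn ltnS size_npoly.
  by rewrite monicE lead_coefDl // lead_coefXn size_polyDl // size_polyXn.
have szp : h - 'X^n \is a poly_of_size n.
  rewrite qualifE /=; apply/leq_sizeP => j le_nj.
  rewrite coefB coefXn; have [->|ne_jn] := eqVneq j n.
    by move: mon_h; rewrite monicE /lead_coef size_h /= => /eqP ->; rewrite subrr.
  by rewrite subr0 nth_default // size_h ltn_neqAle eq_sym ne_jn.
by exists (NPoly szp); rewrite ?mem_enum //= addrC subrK.
Qed.

Lemma monics_uniq n : uniq (monics n).
Proof. by rewrite map_inj_uniq ?enum_uniq // => p q /addrI /val_inj. Qed.

Lemma irreducibles_uniq n : uniq (irreducibles n).
Proof. by rewrite filter_uniq ?monics_uniq. Qed.

Lemma mem_irreducibles n P :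
  (P \in irreducibles n) =
  [&& irreducibleb P, P \is monic & size P == n.+1].
Proof. by rewrite mem_filter mem_monics. Qed.

Lemma monics_mul m n P Q :
  P \in monics m -> Q \in monics n -> P * Q \in monics (m + n).
Proof.
rewrite !mem_monics => /andP[monP /eqP sP] /andP[monQ /eqP sQ].
by rewrite rpredM //= size_mul ?monic_neq0 // sP sQ addnS.
Qed.

Lemma perm_monics_dvd m n P : P \in monics m ->
  perm_eq [seq h <- monics (m + n) | P %| h] [seq P * h | h <- monics n].
Proof.
move=> Pm; have := Pm; rewrite mem_monics => /andP[monP /eqP sP].
have P_neq0 := monic_neq0 monP.
apply: uniq_perm; first by rewrite filter_uniq ?monics_uniq.
  by rewrite map_inj_uniq ?monics_uniq // => h1 h2 /(mulfI P_neq0).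
move=> h; rewrite mem_filter; apply/andP/mapP => [[/dvdpP[q ->] hm]|[h' h'm ->]].
  exists q; last by rewrite mulrC.
  move: hm; rewrite !mem_monics monicMr // => /andP[mon_q].
  rewrite mon_q size_mul ?monic_neq0 // sP addnS /=.
  by rewrite addnC -addnS eqn_add2l.
by rewrite dvdp_mulr // monics_mul.
Qed.

(** A monic divisor of least positive degree is irreducible. *)
Lemma irreducible_divisor h : h \is monic -> (1 < size h)%N ->
  exists n P, [/\ (0 < n)%N, P \in irreducibles n & P %| h].
Proof.
move=> mon_h h_gt1.
pose dvd_h n := (0 < n)%N && has (fun P => P %| h) (monics n).
have ex_dvd : exists n, dvd_h n.
  have h_gt0 : (0 < size h)%N by apply: ltnW.
  exists (size h).-1; rewrite /dvd_h -ltnS prednK // h_gt1 /=.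
  by apply/hasP; exists h; rewrite ?dvdpp // mem_monics mon_h prednK /=.
case: (ex_minnP ex_dvd) => n /andP[n_gt0 /hasP[P Pn P_dvd_h]] min_n.
have := Pn; rewrite mem_monics => /andP[monP /eqP sP].
exists n, P; split=> //; rewrite mem_irreducibles monP sP eqxx !andbT.
apply/irreducibleP; split=> [|q q_neq1 q_dvd_P]; first by rewrite sP.
have q_neq0 : q != 0.
  by apply: contraTneq q_dvd_P => ->; rewrite dvd0p monic_neq0.
have lq_neq0 : (lead_coef q)^-1 != 0 by rewrite invr_eq0 lead_coef_eq0.
rewrite -dvdp_size_eqp // eqn_leq dvdp_leq ?monic_neq0 //= sP.
have q_gt0 : (0 < size q)%N by rewrite size_poly_gt0.
suff /min_n : dvd_h (size q).-1 by rewrite -ltnS prednK.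
apply/andP; split; first by case: (size q) q_gt0 q_neq1 => [|[]].
apply/hasP; exists ((lead_coef q)^-1 *: q); last first.
  by rewrite dvdpZl //; apply: dvdp_trans P_dvd_h.
rewrite mem_monics monicE lead_coefZ mulVf ?lead_coef_eq0 // eqxx /=.
by rewrite size_scale // prednK.
Qed.

Lemma dvdp_exp_mul_irreducible m n P Q h k :
  P \in irreducibles m -> Q \in irreducibles n -> P != Q ->
  (P ^+ k %| Q * h) = (P ^+ k %| h).
Proof.
rewrite !mem_irreducibles => /and3P[/irreducibleP irrP monP _].
case/and3P=> /irreducibleP irrQ monQ _ neqPQ.
rewrite Gauss_dvdpr // coprimep_expl // irreducible_poly_coprime //.
apply: contra neqPQ => P_dvd_Q; rewrite -eqp_monic //.
by apply: irrQ.2 => //; rewrite neq_ltn irrP.1 orbT.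
Qed.

(** The polynomial form of the identity expressing [log n] as the sum of von Mangoldt's function
    over the divisors of [n]. Removing one irreducible factor [P0] from [h] loses exactly one prime
    power, of weight the degree of [P0]. The bound [N] on the ranges stays fixed during the
    induction. *)
Lemma sum_degrees_of_prime_powers N n h : (n <= N)%N -> h \in monics n ->
  (\sum_(1 <= s < N.+1) \sum_(P <- irreducibles s)
      s * \sum_(1 <= k < N.+1) (P ^+ k %| h)%R = n)%N.
Proof.
elim/ltn_ind: n h => n IHn h le_nN hn; have := hn.
rewrite mem_monics => /andP[mon_h /eqP size_h].
have [n0|n_gt0] := posnP n.
  have h1 : h = 1.
    by apply/eqP; rewrite -eqp_monic ?monic1 // -size_poly_eq1 size_h n0.
  rewrite n0; apply: big1_seq => s /andP[_]; rewrite mem_index_iota => /andP[s_gt0 _].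
  apply: big1_seq => P /andP[_]; rewrite mem_irreducibles => /and3P[_ monP /eqP sP].
  apply/eqP; rewrite muln_eq0; apply/orP; right; rewrite big1_seq // => k /andP[_].
  rewrite mem_index_iota => /andP[k_gt0 _]; apply/eqP; rewrite eqb0 h1 dvdp1.
  rewrite -(prednK (n := size (P ^+ k))) ?size_poly_gt0 ?expf_neq0 ?monic_neq0 //.
  by rewrite size_exp sP eqSS muln_eq0 negb_or -!lt0n s_gt0 k_gt0.
have [|s0 [P0 [s0_gt0 P0s dvd_h]]] := irreducible_divisor mon_h.
  by rewrite size_h.
have := P0s; rewrite mem_irreducibles => /and3P[irrP0 monP0 /eqP sP0].
have [h2 hE] : exists h2, h = P0 * h2.
  by case/dvdpP: dvd_h => q ->; exists q; rewrite mulrC.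
have [n2 h2m nE] : exists2 n2, h2 \in monics n2 & n = (s0 + n2)%N.
  have /andP[P0_neq0 h2_neq0] : (P0 != 0) && (h2 != 0).
    by rewrite -negb_or -mulf_eq0 -hE monic_neq0.
  have h2_gt0 : (0 < size h2)%N by rewrite size_poly_gt0.
  move: hn; rewrite mem_monics hE monicMl // size_mul // sP0.
  case/andP=> mon_h2; rewrite addSn /= => /eqP sh2.
  exists (size h2).-1; first by rewrite mem_monics mon_h2 prednK /=.
  by case: (size h2) h2_gt0 sh2 => // k _; rewrite addnS => -[].
have IH2 : (\sum_(1 <= s < N.+1) \sum_(P <- irreducibles s)
      s * \sum_(1 <= k < N.+1) (P ^+ k %| h2)%R = n2)%N by apply: IHn => //; lia.
rewrite nE -{}IH2.
have s0_in : s0 \in index_iota 1 N.+1 by rewrite mem_index_iota s0_gt0; lia.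
rewrite (bigD1_seq s0) ?iota_uniq //= [X in (_ = s0 + X)%N](bigD1_seq s0) ?iota_uniq //=.
rewrite addnA; congr addn; last first.
  apply: eq_bigr => s ne_s; apply: eq_big_seq => P Ps.
  congr muln; apply: eq_bigr => k _; rewrite hE (dvdp_exp_mul_irreducible _ _ Ps P0s) //.
  apply: contraNneq ne_s => eqPP; move: Ps; rewrite eqPP mem_irreducibles sP0.
  by case/and3P=> _ _ /eqP[->].
rewrite (bigD1_seq P0) ?irreducibles_uniq //= [X in (_ = s0 + X)%N](bigD1_seq P0) ?irreducibles_uniq //=.
rewrite addnA; congr addn; last first.
  rewrite big_seq_cond [RHS]big_seq_cond; apply: eq_bigr => P /andP[Ps ne_P].
  by congr muln; apply: eq_bigr => k _; rewrite hE (dvdp_exp_mul_irreducible _ _ Ps P0s).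
rewrite -mulnS; congr muln.
have N_gt0 : (0 < N)%N by lia.
rewrite big_nat_recl // expr1 hE dvdp_mulr //= add1n; congr S.
(* Multiplication by [P0] shifts the exponents by one. The top term for [h2] vanishes, since
   [P0 ^+ N] has degree at least [N] and [h2] has degree below [N]. *)
rewrite [RHS]big_nat_recr //= [X in (_ + X)%N](_ : _ = 0%N) ?addn0; last first.
  apply/eqP; rewrite eqb0; apply/negP => /(dvdp_leq _).
  rewrite monic_neq0; last by move: h2m; rewrite mem_monics => /andP[].
  move=> /(_ isT); rewrite leqNgt => /negP; apply.
  move: h2m; rewrite mem_monics => /andP[_ /eqP ->].
  rewrite -(prednK (n := size (P0 ^+ N))) ?size_poly_gt0 ?expf_neq0 ?monic_neq0 //.
  by rewrite size_exp sP0 ltnS /=; apply: leq_trans (leq_pmull _ s0_gt0); lia.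
apply: eq_big_nat => k _; rewrite exprS dvdp_mul2l //.
by rewrite monic_neq0.
Qed.

Lemma sum_factorisations (V : nmodType) n (G : nat -> nat -> V) :
  \sum_(1 <= s < n.+1) \sum_(1 <= k < n.+1 | (s * k <= n)%N) G s k =
  \sum_(1 <= j < n.+1) \sum_(1 <= s < j.+1 | (s %| j)%N) G s (j %/ s)%N.
Proof.
have -> : \sum_(1 <= j < n.+1) \sum_(1 <= s < j.+1 | (s %| j)%N) G s (j %/ s)%N =
    \sum_(1 <= j < n.+1) \sum_(1 <= s < n.+1 | (s %| j)%N) G s (j %/ s)%N.
  apply: eq_big_nat => j /andP[j_gt0 lt_j].
  rewrite [RHS](@big_cat_nat _ _ _ j.+1) //= [X in _ + X]big1_seq ?addr0 // => s.
  rewrite mem_index_iota => /and3P[dvd_sj lt_js _].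
  by have := dvdn_leq j_gt0 dvd_sj; rewrite leqNgt lt_js.
rewrite [RHS](exchange_big_dep_nat (fun s => true)) //=.
apply: eq_big_nat => s /andP[s_gt0 _].
rewrite -[LHS]big_filter -[RHS]big_filter -[RHS](big_map (fun j => j %/ s)%N xpredT (G s)).
apply: perm_big; apply: uniq_perm; first by rewrite filter_uniq ?iota_uniq.
  rewrite map_inj_in_uniq ?filter_uniq ?iota_uniq // => j1 j2.
  rewrite !mem_filter => /andP[d1 _] /andP[d2 _] eq12.
  by rewrite -(divnK d1) eq12 divnK.
move=> k; rewrite mem_filter mem_index_iota; apply/andP/mapP.
  case=> le_sk /andP[k_gt0 _]; exists (s * k)%N; last by rewrite mulKn.
  by rewrite mem_filter dvdn_mulr // mem_index_iota muln_gt0 s_gt0 k_gt0.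
case=> j; rewrite mem_filter mem_index_iota => /and3P[dvd_sj j_gt0 lt_jn] ->.
rewrite mulnC divnK //; split=> //; rewrite divn_gt0 // dvdn_leq //=.
by rewrite ltnS (leq_trans (leq_div _ _)).
Qed.

Variables (C : comPzRingType) (Lam : {poly F} -> C).

(** The coefficient of degree [n] of the L-function of [Lam]. *)
Definition coef_L n : C := \sum_(h <- monics n) Lam h.

(** The coefficient of degree [j] of [T * L' / L], read off from the Euler product. For the weights
    considered later it is a character sum over the extension of degree [j]. *)
Definition power_sum_L j : C :=
  \sum_(1 <= s < j.+1 | (s %| j)%N) \sum_(P <- irreducibles s)
     s%:R * Lam P ^+ (j %/ s).

(* The logarithmic derivative of the Euler product. *)
Lemma newton_L n : {morph Lam : P Q / P * Q} -> Lam 1 = 1 ->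
  n%:R * coef_L n = \sum_(1 <= j < n.+1) power_sum_L j * coef_L (n - j).
Proof.
move=> LamM Lam1.
have LamX P k : Lam (P ^+ k) = Lam P ^+ k.
  by elim: k => [|k IHk]; rewrite ?expr0 // !exprS LamM IHk.
have monicsX s P k : P \in irreducibles s -> P ^+ k \in monics (s * k).
  rewrite mem_irreducibles => /and3P[_ monP /eqP sP]; elim: k => [|k IHk].
    by rewrite muln0 mem_monics monic1 size_poly1.
  by rewrite exprS mulnS monics_mul // mem_monics monP sP /=.
(* In each term the factor [n] is replaced by the sum of the degrees of the prime powers dividing
   [h]. Afterwards the multiples of [P ^+ k] are parametrized by their cofactors, of degree
   [n - s * k]. *)
transitivity (\sum_(1 <= s < n.+1) \sum_(P <- irreducibles s)
  \sum_(1 <= k < n.+1) s%:R * \sum_(h <- monics n | P ^+ k %| h) Lam h).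
  rewrite /coef_L mulr_sumr; transitivity (\sum_(h <- monics n) 
     \sum_(1 <= s < n.+1) \sum_(P <- irreducibles s) \sum_(1 <= k < n.+1)
        s%:R * ((P ^+ k %| h)%R : nat)%:R * Lam h).
    apply: eq_big_seq => h hm; rewrite -{1}(sum_degrees_of_prime_powers (leqnn n) hm).
    rewrite natr_sum mulr_suml; apply: eq_bigr => s _.
    rewrite natr_sum mulr_suml; apply: eq_bigr => P _.
    by rewrite natrM natr_sum mulr_sumr mulr_suml; apply: eq_bigr.
  rewrite exchange_big; apply: eq_bigr => s _.
  rewrite exchange_big; apply: eq_bigr => P _.
  rewrite exchange_big; apply: eq_bigr => k _.
  rewrite mulr_sumr [RHS]big_mkcond; apply: eq_bigr => h _.
  by case: (_ %| _); rewrite ?mulr1 ?mulr0 ?mul0r.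
pose G s k := \sum_(P <- irreducibles s) s%:R * Lam P ^+ k * coef_L (n - s * k).
transitivity (\sum_(1 <= j < n.+1) \sum_(1 <= s < j.+1 | (s %| j)%N) G s (j %/ s)%N);
  last first.
  apply: eq_bigr => j _; rewrite mulr_suml; apply: eq_bigr => s dvd_sj.
  by rewrite mulr_suml; apply: eq_bigr => P _; rewrite [(s * _)%N]mulnC divnK.
rewrite -sum_factorisations; apply: eq_bigr => s _.
rewrite exchange_big [RHS]big_mkcond; apply: eq_bigr => k _ /=.
case: ifP => [le_skn|/negbT gt_skn].
  apply: eq_big_seq => P Ps; rewrite -mulrA; congr (_ * _).
  have := perm_monics_dvd (n - s * k) (monicsX s P k Ps); rewrite subnKC // => eq_dvd.
  rewrite -big_filter (perm_big _ eq_dvd) big_map mulr_sumr.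
  by apply: eq_bigr => h _; rewrite LamM LamX.
apply: big1_seq => P /andP[_ Ps].
rewrite big1_seq ?mulr0 // => h /andP[P_dvd_h].
have := monicsX s P k Ps; rewrite !mem_monics => /andP[_ /eqP sP] /andP[mon_h /eqP sh].
have := dvdp_leq (monic_neq0 mon_h) P_dvd_h.
by rewrite sP sh ltnS (negPf gt_skn).
Qed.

End MonicPolynomials.

(** * Extensions of finite fields *)

Lemma exists_frobenius (E : fieldType) p k : p \in [pchar E] ->
  exists phi : {rmorphism E -> E}, forall x, phi x = x ^+ (p ^ k).
Proof.
move=> charE; elim: k => [|k [phi phiE]]; first by exists idfun => x; rewrite expr1.
exists (pFrobenius_aut charE \o phi) => x /=.
by rewrite phiE pFrobenius_autE -exprM expnSr.
Qed.

(** The extension is a splitting field of ['X^(#|F| ^ j) - 'X]. The roots are distinct and form the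
    fixed field of the [j]-th power of the Frobenius automorphism; as they also generate the
    extension, they exhaust it. *)
Lemma finField_extension (F : finFieldType) j : (0 < j)%N ->
  exists (E : finFieldType) (iota : {rmorphism F -> E}), #|E| = (#|F| ^ j)%N.
Proof.
move=> j_gt0; pose q (R : nzRingType) : {poly R} := 'X^(#|F| ^ j) - 'X.
have m_gt1 : (1 < #|F| ^ j)%N.
  by rewrite -(exp1n j) ltn_exp2r // finNzRing_gt1.
have q_neq0 : q F != 0.
  rewrite -size_poly_eq0 size_polyDl size_polyXn // size_polyN size_polyX.
  by rewrite ltnS.
have [L splitL] := FinSplittingFieldFor q_neq0.
have q_map : map_poly (in_alg L) (q F) = q L.
  by rewrite rmorphB rmorphXn /= map_polyX.
rewrite q_map in splitL.
pose Fm := FinFieldExtType L; exists Fm, (in_alg L).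
have /finField_galois_generator[/= a _ Da]: (1 <= {:L})%VS by apply: sub1v.
pose Em := fixedSpace (a ^+ j)%g; rewrite dimv1 expn1 in Da.
have [zs DqL defL] := splitL.
have m_0 : (#|F| ^ j)%:R = 0 :> L.
  rewrite -(rmorph_nat (in_alg L)) natrX.
  have -> : #|F|%:R = 0 :> F 
    by apply/eqP; rewrite -FinRing.Theory.zmodXgE -order_dvdn -cardsT order_dvdG ?inE.
  by rewrite expr0n gtn_eqF // rmorph0.
have Dq R : q R = ('X^((#|F| ^ j).-1) - 1) * ('X - 0).
  by rewrite subr0 mulrBl mul1r -exprSr prednK //; exact: ltnW.
have Uzs: uniq zs.
  rewrite -separable_prod_XsubC -(eqp_separable DqL) Dq separable_root andbC.
  rewrite /root !hornerE subr_eq0 eq_sym expr0n gtn_eqF ?oner_eq0 //=; last first.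
    by rewrite -ltnS prednK //; exact: ltnW.
  rewrite cyclotomic.separable_Xn_sub_1 // -subn1 natrB; last exact: ltnW.
  rewrite subr_eq0.
  by rewrite m_0 eq_sym oner_eq0.
suffices /eq_card->: Fm =i zs.
  apply: succn_inj; rewrite (card_uniqP _) //= -(size_prod_XsubC _ id).
  by rewrite -(eqp_size DqL) size_polyDl size_polyXn // size_polyN size_polyX.
have in_zs: zs =i Em.
  move=> z; rewrite -root_prod_XsubC -(eqp_root DqL) (sameP fixedSpaceP eqP).
  rewrite /root !hornerE subr_eq0 /=; congr (_ == z).
  elim: (j) => [|i IHi]; first by rewrite gal_id.
  by rewrite expgSr expnSr exprM IHi galM ?Da ?memvf.
suffices defEm: Em = {:L}%VS by move=> z; rewrite in_zs defEm memvf.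
apply/eqP; rewrite eqEsubv subvf -defL -[Em]subfield_closed agenvS //.
by rewrite subv_add sub1v; apply/span_subvP=> z; rewrite in_zs.
Qed.

Section Extension.

Variables (F E : finFieldType) (emb : {rmorphism F -> E}) (j : nat).
Hypotheses (j_gt0 : (0 < j)%N) (card_E : #|E| = (#|F| ^ j)%N).

Let q := #|F|.
Local Notation "P ^emb" := (map_poly emb P) (at level 2, format "P ^emb").

Let frob : exists phi : {rmorphism E -> E}, forall x, phi x = x ^+ q.
Proof.
have [p p_pr charF] := finPcharP F.
have [k qE] : exists k, q = (p ^ k)%N.
  exists (logn p #|F|); exact: (card_pprimeChar charF).
rewrite qE; apply: exists_frobenius.
by rewrite (fmorph_pchar emb).
Qed.

Lemma frobenius_fixed (x : E) : x ^+ q = x -> exists a, x = emb a.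
Proof.
move=> xq; have := congr1 (fun P => P^emb.[x]) (finField_genPoly F).
rewrite rmorphB rmorphXn /= !map_polyX !hornerE xq subrr.
rewrite rmorph_prod horner_prod => /esym/eqP/prodf_eq0[a _].
rewrite rmorphB /= map_polyX map_polyC !hornerE subr_eq0 => /eqP.
by exists a.
Qed.

(** With [t] the least period of [x] under Frobenius, the product over its orbit is invariant under
    Frobenius and so has coefficients in [F]. Since [j] is a period, [t] divides it. *)
Lemma exists_conjugate_poly (x : E) :
  exists t (Q : {poly F}), [/\ (0 < t)%N, (t %| j)%N, x ^+ (q ^ t) = x,
    Q^emb = \prod_(i < t) ('X - (x ^+ (q ^ i))%:P) &
    uniq [seq x ^+ (q ^ i) | i <- iota 0 t] ].
Proof.
have [phi phiE] := frob.
have phi_pw i : phi (x ^+ (q ^ i)) = x ^+ (q ^ i.+1).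
  by rewrite phiE -exprM -expnSr.
have iter_phi k i : iter k phi (x ^+ (q ^ i)) = x ^+ (q ^ (k + i)).
  by elim: k => //= k ->; rewrite phi_pw.
pose periodic t := (0 < t)%N && (x ^+ (q ^ t) == x).
have pw_j : x ^+ (q ^ j) = x by rewrite -card_E expf_card.
have ex_t : exists t, periodic t by exists j; rewrite /periodic j_gt0 pw_j eqxx.
case: (ex_minnP ex_t) => t /andP[t_gt0 /eqP pw_t] min_t.
pose R : {poly E} := \prod_(i < t) ('X - (x ^+ (q ^ i))%:P).
have phiR : map_poly phi R = R.
  rewrite rmorph_prod /R; case: (t) t_gt0 pw_t => // t' _ pw_t'.
  rewrite big_ord_recl big_ord_recr /= mulrC; congr (_ * _).
    by rewrite rmorphB /= map_polyX map_polyC /= phi_pw pw_t' expn0 expr1.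
  by apply: eq_bigr => i _; rewrite rmorphB /= map_polyX map_polyC /= phi_pw.
(* A set-theoretic left inverse of [emb]; [g 0 = 0] is enough for [map_poly g] to act
   coefficientwise. *)
pose g (y : E) : F := odflt 0 [pick a | emb a == y].
have gK y : y ^+ q = y -> emb (g y) = y.
  case/frobenius_fixed=> a ->; rewrite /g; case: pickP => [b /eqP //|/(_ a)].
  by rewrite eqxx.
have g0 : g 0 = 0.
  by apply: (fmorph_inj emb); rewrite gK ?rmorph0 // expr0n gtn_eqF // ltnW // finNzRing_gt1.
have pw_dvd k : x ^+ (q ^ k) = x -> (t %| k)%N.
  move=> pw_k; rewrite /dvdn -leqn0. rewrite leqNgt; apply/negP => r_gt0.
  have : periodic (k %% t)%N.
    rewrite /periodic r_gt0 /= -[X in _ == X]pw_k {2}(divn_eq k t).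
    by elim: (k %/ t)%N => [|d IHd] //; rewrite mulSn -addnA expnD exprM pw_t.
  by move/min_t; rewrite leqNgt ltn_mod t_gt0.
exists t, (map_poly g R); split=> //; first exact: pw_dvd.
  apply/polyP => k; rewrite coef_map coef_map_id0 //= gK //.
  by rewrite -phiE -coef_map phiR.
rewrite map_inj_in_uniq ?iota_uniq // => i1 i2.
rewrite !mem_iota !add0n /=.
wlog le_i : i1 i2 / (i1 <= i2)%N.
  by move=> wl; case/orP: (leq_total i1 i2) => le_i lt1 lt2 eq_i; [|apply/esym]; apply: wl.
move=> _ lt_i2 eq_i; apply/eqP; rewrite eqn_leq le_i /= leqNgt -subn_gt0.
have: x = x ^+ (q ^ (i2 - i1)).
  have /(_ i1) inj_it : forall k, injective (iter k phi).
    by elim=> // k IHk y z /= /fmorph_inj /IHk.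
  by apply: inj_it; rewrite -{1}[x]expr1 -(expn0 q) !iter_phi addn0 subnKC.
move=> /esym pw_i; apply/negP => i_gt0.
have : periodic (i2 - i1)%N by rewrite /periodic i_gt0 pw_i eqxx.
by move/min_t; rewrite leqNgt (leq_ltn_trans (leq_subr _ _)).
Qed.

(** Every conjugate of [x] is a root of [P], so the product over the orbit, which descends to [F],
    divides the irreducible [P] and equals it. *)
Lemma irreducible_root_conjugates s P (x : E) :
  P \in irreducibles F s -> root P^emb x ->
  [/\ (s %| j)%N, x ^+ (q ^ s) = x,
     P^emb = \prod_(i < s) ('X - (x ^+ (q ^ i))%:P) &
     uniq [seq x ^+ (q ^ i) | i <- iota 0 s]].
Proof.
rewrite mem_irreducibles => /and3P[/irreducibleP irrP monP /eqP sP] Px.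
have [phi phiE] := frob.
have [t [Q [t_gt0 tj pw_t QE uniq_t]]] := exists_conjugate_poly x.
have Q_prod : Q^emb = \prod_(y <- [seq x ^+ (q ^ i) | i <- iota 0 t]) ('X - y%:P).
  by rewrite big_map QE -[t in iota 0 t]subn0 -/(index_iota 0 t) big_mkord.
have rootsP i : root P^emb (x ^+ (q ^ i)).
  elim: i => [|i IHi]; first by rewrite expr1.
  rewrite expnSr exprM -phiE.
  have -> : P^emb = map_poly phi P^emb.
    rewrite -map_poly_comp; apply: eq_map_poly => a /=.
    by rewrite phiE -rmorphXn /= expf_card.
  by rewrite fmorph_root.
have monQ : Q \is monic.
  by rewrite -(map_monic emb) QE monic_prod // => i _; rewrite monicXsubC.
have sQ : size Q = t.+1.
  by rewrite -(size_map_poly emb) QE size_prod_XsubC /index_enum -enumT size_enum_ord.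
have : Q %| P.
  rewrite -(dvdp_map emb) Q_prod uniq_roots_dvdp //.
    by apply/allP => y /mapP[i _ ->]; apply: rootsP.
  by rewrite uniq_rootsE.
have Q_neq1 : size Q != 1%N by rewrite sQ eqSS -lt0n.
move/(irrP.2 Q Q_neq1); rewrite eqp_monic // => /eqP QP.
have <- : t = s by apply: succn_inj; rewrite -sQ -sP QP.
by rewrite -QP.
Qed.

(** A root [z] of [P] in the field of order [q ^ s] satisfies [z ^+ (q ^ j) = z], because [s]
    divides [j]. Hence [P] divides ['X^(q ^ j) - 'X], which splits in [E]. *)
Lemma irreducible_has_root s P : (s %| j)%N -> P \in irreducibles F s ->
  exists x : E, root P^emb x.
Proof.
move=> s_dvd; rewrite mem_irreducibles => /and3P[/irreducibleP irrP monP /eqP sP].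
have P_dvd : P %| 'X^(q ^ j) - 'X.
  have [L dimL [z Pz _]] := irredp_FAdjoin irrP.
  apply: contraLR isT => ndvd.
  have cop : coprimep P ('X^(q ^ j) - 'X) by rewrite irreducible_poly_coprime.
  have : coprimep (map_poly (in_alg L) P) (map_poly (in_alg L) ('X^(q ^ j) - 'X)).
    by rewrite coprimep_map.
  move/coprimep_root/(_ Pz); rewrite rmorphB rmorphXn /= map_polyX !hornerE.
  suff -> : z ^+ (q ^ j) = z by rewrite subrr eqxx.
  have zs : z ^+ (q ^ s) = z.
    have := expf_card (z : FinFieldExtType L).
    have -> : #|FinFieldExtType L| = (#|F| ^ \dim {:L})%N.
      rewrite dimvf -[dim L]mul1n -card_mx.
      have bij : bijective (VectorInternalTheory.v2r : FinFieldExtType L -> 'rV[F]_(dim L)).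
        exists VectorInternalTheory.r2v;
          [exact: VectorInternalTheory.v2rK|exact: VectorInternalTheory.r2vK].
      exact: bij_eq_card bij.
    by rewrite dimL sP.
  case/dvdnP: s_dvd => d ->; elim: d => [|d IHd]; first by rewrite expr1.
  by rewrite mulSn expnD exprM zs.
have : P^emb %| ('X^(q ^ j) - 'X)^emb by rewrite dvdp_map.
rewrite rmorphB rmorphXn /= map_polyX -card_E finField_genPoly.
move=> P_dvd_prod; have : size P^emb != 1%N.
  by rewrite size_map_poly sP eqSS; case: irrP; rewrite sP ltnS lt0n.
have [m Pm] := dvdp_prod_XsubC P_dvd_prod.
rewrite (eqp_size Pm) size_prod_XsubC eqSS -lt0n.
case: (mask m _) Pm => // x r Px _; exists x.
by rewrite (eqp_root Px) root_prod_XsubC mem_head.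
Qed.

(** The left side is the norm of [emb b - x]: the [j] conjugates of [x] run [j %/ s] times through
    the roots of [P]. *)
Lemma norm_root s P (x : E) b : P \in irreducibles F s -> root P^emb x ->
  (emb b - x) ^+ (\sum_(i < j) q ^ i) = emb (P.[b] ^+ (j %/ s)).
Proof.
move=> Ps Px; have [/divnK s_j pw_s PE _] := irreducible_root_conjugates Ps Px.
have [phi phiE] := frob.
have pwB i : (emb b - x) ^+ (q ^ i) = emb b - x ^+ (q ^ i).
  elim: i => // i IHi; rewrite expnSr !exprM IHi -!phiE rmorphB /=.
  by rewrite [phi (emb b)]phiE -rmorphXn /= expf_card.
rewrite expr_sum; under eq_bigr do rewrite pwB.
rewrite rmorphXn /= -horner_map PE horner_prod /=.
under [in RHS]eq_bigr do rewrite !hornerE.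
rewrite -[in LHS]s_j; elim: (j %/ s)%N => [|d IHd]; first by rewrite big_ord0.
rewrite mulSn big_split_ord exprS /= -IHd; congr (_ * _).
by apply: eq_bigr => i _; rewrite expnD exprM pw_s.
Qed.

(** Grouping the elements of [E] by minimal polynomial: each irreducible of degree [s] dividing [j]
    has exactly [s] roots in [E], which accounts for the factor [s%:R]. *)
Lemma sum_over_minimal_polynomials (C : comPzRingType) (Lam : {poly F} -> C)
    (w : E -> C) :
  (forall s P x, P \in irreducibles F s -> root P^emb x ->
     w x = Lam P ^+ (j %/ s)) ->
  \sum_x w x = power_sum_L Lam j.
Proof.
move=> wE; transitivity (\sum_(1 <= s < j.+1 | (s %| j)%N)
  \sum_(P <- irreducibles F s) \sum_(x | root P^emb x) w x); last first.
  apply: eq_bigr => s s_dvd; apply: eq_big_seq => P Ps.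
  rewrite (eq_bigr (fun=> Lam P ^+ (j %/ s))) => [|x Px]; last exact: wE Px.
  rewrite sumr_const mulr_natl; congr (_ *+ _).
  have [x Px] := irreducible_has_root s_dvd Ps.
  have [_ _ PE uniq_s] := irreducible_root_conjugates Ps Px.
  transitivity #|[seq x ^+ (q ^ i) | i <- iota 0 s]|.
    apply: eq_card => y; rewrite -root_prod_XsubC big_map PE.
    by rewrite -[s in iota 0 s]subn0 -/(index_iota 0 s) big_mkord.
  by rewrite (card_uniqP uniq_s) size_map size_iota.
under [RHS]eq_bigr do under eq_bigr do rewrite big_mkcond /=.
under [RHS]eq_bigr do rewrite exchange_big /=.
rewrite exchange_big /=; apply: eq_bigr => x _.
have [s [P [s_gt0 Ps Px]]] : exists s P,
    [/\ (0 < s)%N, P \in irreducibles F s & root P^emb x].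
  have [t [Q [t_gt0 tj pw_t QE uniq_t]]] := exists_conjugate_poly x.
  have monQ : Q \is monic.
    by rewrite -(map_monic emb) QE monic_prod // => i _; rewrite monicXsubC.
  have sQ : size Q = t.+1.
    by rewrite -(size_map_poly emb) QE size_prod_XsubC /index_enum -enumT size_enum_ord.
  have [|s [P [s_gt0 Ps P_dvd]]] := irreducible_divisor monQ; first by rewrite sQ.
  exists s, P; split=> //.
  have : P^emb %| Q^emb by rewrite dvdp_map.
  have : size P^emb != 1%N.
    by move: Ps; rewrite mem_irreducibles size_map_poly => /and3P[_ _ /eqP ->]; rewrite eqSS -lt0n.
  rewrite QE => sP P_dvd'; have [m Pm] := dvdp_prod_XsubC P_dvd'.
  move: sP; rewrite (eqp_size Pm) size_prod_XsubC eqSS -lt0n.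
  case: (mask m _) Pm => // i r Pi _.
  have Py : root P^emb (x ^+ (q ^ i)).
    by rewrite (eqp_root Pi) big_cons rootM root_XsubC eqxx.
  have [phi phiE] := frob.
  have phi_root y : root P^emb y -> root P^emb (y ^+ q).
    rewrite -phiE -(fmorph_root phi) -map_poly_comp.
    by congr (root _ _); apply: eq_map_poly => a /=; rewrite phiE -rmorphXn /= expf_card.
  (* The irreducible factor found vanishes at some conjugate of [x]; [t - i] further Frobenius steps
     lead back to [x]. *)
  have : root P^emb (x ^+ (q ^ i) ^+ (q ^ (t - i))).
    elim: (t - i)%N => [|k IHk]; first by rewrite expr1.
    by rewrite expnSr exprM phi_root.
  by rewrite -exprM -expnD subnKC ?pw_t // ltnW.
have [s_dvd _ _ _] := irreducible_root_conjugates Ps Px.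
have root_uniq s' P' : P' \in irreducibles F s' -> root P'^emb x -> P' = P.
  move=> Ps' Px'; apply/eqP; apply: contraLR isT => neP.
  have [irrP' _ _] := and3P (etrans (esym (mem_irreducibles s' P')) Ps').
  have [irrP _ _] := and3P (etrans (esym (mem_irreducibles s P)) Ps).
  have : coprimep P^emb P'^emb.
    rewrite coprimep_map irreducible_poly_coprime; last exact/irreducibleP.
    apply: contra neP => P_dvd; rewrite eq_sym.
    move: Ps Ps'; rewrite !mem_irreducibles => /and3P[_ monP sP] /and3P[_ monP' _].
    rewrite -eqp_monic //; apply: (irreducibleP _ irrP').2 => //.
    by rewrite (eqP sP) eqSS -lt0n.
  by move/coprimep_root/(_ Px); rewrite -rootE Px'.
have s_in : s \in index_iota 1 j.+1 by rewrite mem_index_iota s_gt0 ltnS dvdn_leq.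
rewrite (big_rem s) //= s_dvd (big_rem P) //= Px.
rewrite [X in _ + X + _]big1_seq ?addr0 => [|P' /andP[_]]; last first.
  rewrite mem_rem_uniq ?irreducibles_uniq // inE => /andP[neP Ps'].
  by case: ifP => // /(root_uniq _ _ Ps') eqP'; rewrite eqP' eqxx in neP.
rewrite big1_seq ?addr0 // => s' /andP[_].
rewrite mem_rem_uniq ?iota_uniq // inE => /andP[ne_s _].
apply: big1_seq => P' /andP[_ Ps']; case: ifP => // Px'.
have eqP' := root_uniq _ _ Ps' Px'; move: Ps' Ps ne_s.
rewrite eqP' !mem_irreducibles => /and3P[_ _ /eqP ->] /and3P[_ _ /eqP [->]].
by rewrite eqxx.
Qed.

End Extension.

(** * Power sums of the inverse roots *)

(* The logarithmic derivative of [prod (1 - w X)], truncated at order [N]. *)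
Lemma newton_prod_1subX (C : comNzRingType) N (ws : seq C) :
  exists r : {poly C},
    'X * (\prod_(w <- ws) (1 - w *: 'X))^`() =
    - (\sum_(1 <= j < N.+1) (\sum_(w <- ws) w ^+ j) *: 'X^j) *
      \prod_(w <- ws) (1 - w *: 'X) + 'X^(N.+1) * r.
Proof.
elim: ws => [|w ws [r IHr]].
  exists 0; rewrite !big_nil derivC mulr0 mulr0 addr0 mulr1 big1 ?oppr0 // => j _.
  by rewrite big_nil scale0r.
rewrite big_cons; set d := \prod_(_ <- _) _ in IHr *.
set sigma := \sum_(1 <= j < N.+1) _ in IHr.
pose g : {poly C} := \sum_(1 <= j < N.+1) w ^+ j *: 'X^j.
have -> : \sum_(1 <= j < N.+1) (\sum_(v <- w :: ws) v ^+ j) *: 'X^j = g + sigma.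
  by rewrite -big_split; apply: eq_bigr => j _; rewrite big_cons scalerDl.
have gE : g * (1 - w *: 'X) = w *: 'X - w ^+ N.+1 *: 'X^(N.+1).
  have -> : g = \sum_(0 <= j < N) (w *: 'X) ^+ j.+1.
    by rewrite /g big_add1; apply: eq_bigr => j _; rewrite exprZn.
  elim: (N) => [|M IHM]; first by rewrite big_geq // mul0r !expr1 subrr.
  by rewrite big_nat_recr //= mulrDl IHM -!exprZn !exprS; ring.
exists ((1 - w *: 'X) * r - w ^+ N.+1 *: d).
rewrite derivM derivB derivC derivZ derivX sub0r.
have -> : 'X * (- (w *: 1) * d + (1 - w *: 'X) * d^`()) =
    - (w *: 'X) * d + (1 - w *: 'X) * ('X * d^`()).
  by rewrite -!mul_polyC; ring.
rewrite IHr.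
have -> : - (g + sigma) * ((1 - w *: 'X) * d) =
    - (g * (1 - w *: 'X)) * d - sigma * ((1 - w *: 'X) * d) by ring.
by rewrite gE -!mul_polyC; ring.
Qed.

Lemma newton_uniqueness (C : pzRingType) (c S S' : nat -> C) :
  c 0%N = 1 ->
  (forall n, \sum_(1 <= j < n.+1) S j * c (n - j)%N =
             \sum_(1 <= j < n.+1) S' j * c (n - j)%N) ->
  forall j, (0 < j)%N -> S j = S' j.
Proof.
move=> c0 eqSS'; elim/ltn_ind=> j IHj j_gt0; have := eqSS' j.
rewrite !big_nat_recr //= subnn c0 !mulr1.
suff -> : \sum_(1 <= i < j) S i * c (j - i)%N = \sum_(1 <= i < j) S' i * c (j - i)%N.
  by move/addrI.
by apply: eq_big_nat => i /andP[i_gt0 lt_ij]; rewrite IHj.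
Qed.

Lemma prod_1subX_factorisation (C : closedFieldType) (L : {poly C}) :
  L.[0] = 1 ->
  exists2 ws : seq C, size ws = (size L).-1 & L = \prod_(w <- ws) (1 - w *: 'X).
Proof.
move=> L0; have [rs LE] := closed_field_poly_normal L.
have L_neq0 : L != 0 by apply: contra_eq_neq L0 => ->; rewrite horner0 eq_sym oner_eq0.
have lead_neq0 : lead_coef L != 0 by rewrite lead_coef_eq0.
exists (map GRing.inv rs).
  by rewrite size_map [in RHS]LE size_scale // size_prod_XsubC.
have rs_neq0 r : r \in rs -> r != 0.
  move=> r_in; apply: contra_eq_neq L0 => r0.
  suff /rootP -> : root L 0 by rewrite eq_sym oner_eq0.
  by rewrite LE rootZ // root_prod_XsubC -r0.
rewrite big_map.
have prodE : \prod_(r <- rs) ('X - r%:P) =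
    (\prod_(r <- rs) - r) *: \prod_(r <- rs) (1 - r^-1 *: 'X).
  elim: (rs) rs_neq0 => [|r s IHs] s_neq0; first by rewrite !big_nil scale1r.
  rewrite !big_cons IHs => [|x x_in]; last by rewrite s_neq0 // inE x_in orbT.
  have -> : 'X - r%:P = - r *: (1 - r^-1 *: 'X).
    rewrite scalerBr scalerA mulNr mulfV ?s_neq0 ?mem_head // scaleN1r opprK.
    by rewrite alg_polyC polyCN addrC.
  by rewrite -scalerAl -scalerAr scalerA.
rewrite {1}LE prodE scalerA.
have : L.[0] = lead_coef L * \prod_(r <- rs) - r.
  rewrite {1}LE prodE scalerA hornerZ horner_prod [X in _ * X]big1 ?mulr1 // => r _.
  by rewrite !hornerE ?mulr0 ?subr0.
by rewrite L0 => <-; rewrite scale1r.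
Qed.

(** The negated power sums of the inverse roots satisfy the same Newton recursion as [S], and since
    [c 0 = 1] the recursion has only one solution. *)
Lemma power_sums_of_polynomial_L (C : closedFieldType) m (c S : nat -> C) :
  c 0%N = 1 -> (forall n, (m <= n)%N -> c n = 0) ->
  (forall n, n%:R * c n = \sum_(1 <= j < n.+1) S j * c (n - j)%N) ->
  exists2 ws : seq C, (size ws <= m.-1)%N &
    forall j, (0 < j)%N -> S j = - \sum_(w <- ws) w ^+ j.
Proof.
move=> c0 c_ge_m newtonS; pose L := \poly_(i < m) c i.
have cE n : c n = L`_n.
  by rewrite coef_poly; case: ltnP => // /c_ge_m.
have [ws size_ws LE] : exists2 ws : seq C, size ws = (size L).-1 &
    L = \prod_(w <- ws) (1 - w *: 'X).
  by apply: prod_1subX_factorisation; rewrite horner_coef0 -cE.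
exists ws.
  by rewrite size_ws -!subn1 leq_sub2r // size_poly.
apply: (@newton_uniqueness _ c) => // n; rewrite -newtonS.
have [r rE] := newton_prod_1subX n ws.
have := congr1 (fun p : {poly C} => p`_n) rE.
rewrite -LE coefD coefXnM leqnn addr0 coefXM coef_deriv => lhsE.
rewrite cE; transitivity (if n == 0%N then 0 else L`_n.-1.+1 *+ n.-1.+1).
  by case: (n) => [|n']; rewrite ?mul0r //= mulr_natl.
rewrite lhsE mulNr coefN coefM big_ord_recl.
rewrite coef_sum big1_seq ?mul0r ?add0r => [|j]; last first.
  rewrite mem_index_iota => /andP[_ /andP[j_gt0 _]].
  by rewrite coefZ coefXn eq_sym gtn_eqF ?mulr0.
rewrite [in RHS]big_add1 [in RHS]big_mkord -sumrN; apply: eq_bigr => i _.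
rewrite mulNr cE lift0; congr (- (_ * _)).
rewrite coef_sum (bigD1_seq i.+1) ?iota_uniq ?mem_index_iota ?ltnS ?ltn_ord //=.
rewrite coefZ coefXn eqxx mulr1 [X in _ + X]big1 ?addr0 // => k ne_k.
by rewrite coefZ coefXn eq_sym (negPf ne_k) mulr0.
Qed.

Lemma bounded_powers (x K : algC) : 0 <= x -> (forall n, x ^+ n <= K) -> x <= 1.
Proof.
move=> x_ge0 xn_le; have xR : x \is Num.real := ger0_real x_ge0.
rewrite real_leNgt ?real1 //; apply/negP => x_gt1.
pose t := x - 1; have t_gt0 : 0 < t by rewrite subr_gt0.
have bernoulli n : 1 + n%:R * t <= x ^+ n.
  elim: n => [|n IHn]; first by rewrite mul0r addr0.
  rewrite exprS; apply: le_trans (ler_wpM2l x_ge0 IHn).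
  have -> : x = 1 + t by rewrite addrC subrK.
  rewrite -subr_ge0; have -> : (1 + t) * (1 + n%:R * t) - (1 + n.+1%:R * t) = n%:R * t ^+ 2.
    by rewrite -natr1; ring.
  by rewrite mulr_ge0 ?exprn_ge0 ?ler0n // ltW.
have K_ge0 : 0 <= K by apply: le_trans (xn_le 0%N); rewrite expr0 ler01.
have := archi_boundP (divr_ge0 K_ge0 (ltW t_gt0)).
set b := Num.bound _; rewrite ltr_pdivrMr // => lt_K.
have := le_lt_trans (le_trans (bernoulli b) (xn_le b)) lt_K.
by rewrite gtrDr ltr10.
Qed.

(** Let [P] vanish at all elements of [ws] except [w]. Combining consecutive power sums with the
    coefficients of [P] leaves a nonzero multiple of [w ^+ n]. So [(|w| / r) ^+ n] stays bounded,
    whatever the size of [K]. *)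
Lemma power_sum_growth (ws : seq algC) (K r : algC) n0 : 0 < r ->
  (forall n, (n0 <= n)%N -> `|\sum_(w <- ws) w ^+ n| <= K * r ^+ n) ->
  forall w, w \in ws -> `|w| <= r.
Proof.
move=> r_gt0 sum_le w w_ws.
have [->|w_neq0] := eqVneq w 0; first by rewrite normr0 ltW.
pose P := \prod_(u <- rem w (undup ws)) ('X - u%:P).
have Pw : P.[w] != 0.
  rewrite -rootE root_prod_XsubC rem_filter ?undup_uniq // mem_filter /=.
  by rewrite eqxx.
have Pv v : v \in ws -> v != w -> P.[v] = 0.
  move=> v_ws ne_vw; apply/rootP; rewrite root_prod_XsubC.
  by rewrite rem_filter ?undup_uniq // mem_filter /= ne_vw mem_undup.
pose mu := (count_mem w ws)%:R * P.[w].
have mu_neq0 : mu != 0.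
  by rewrite mulf_neq0 // pnatr_eq0 -lt0n -has_count has_pred1.
have sumE n : \sum_(k < size P) P`_k * (\sum_(v <- ws) v ^+ (n + k)) = mu * w ^+ n.
  under eq_bigr do rewrite mulr_sumr.
  rewrite exchange_big /=.
  transitivity (\sum_(v <- ws) (v == w)%:R * (P.[w] * w ^+ n)).
    apply: eq_big_seq => v v_ws.
    transitivity (P.[v] * v ^+ n).
      rewrite horner_coef mulr_suml; apply: eq_bigr => k _.
      by rewrite exprD; ring.
    have [->|ne_vw] := eqVneq v w; first by rewrite mul1r.
    by rewrite Pv // !mul0r.
  rewrite -mulr_suml /mu -mulrA; congr (_ * _).
  rewrite -natr_sum -sum1_count [in RHS]big_mkcond.
  by congr (_%:R); apply: eq_bigr => v _ /=; case: eqP.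
pose K' := \sum_(k < size P) `|P`_k| * K * r ^+ k.
have le_n n : (n0 <= n)%N -> `|mu| * `|w| ^+ n <= K' * r ^+ n.
  move=> le_n0n; rewrite -normrX -normrM -sumE (le_trans (ler_norm_sum _ _ _)) //.
  rewrite mulr_suml; apply: ler_sum => k _; rewrite normrM -!mulrA ler_wpM2l //.
  by rewrite [r ^+ k * _]mulrC -exprD sum_le // (leq_trans le_n0n) ?leq_addr.
have norm_mu_gt0 : 0 < `|mu| by rewrite normr_gt0.
have norm_w_gt0 : 0 < `|w| by rewrite normr_gt0.
suff : `|w| / r <= 1 by rewrite ler_pdivrMr ?mul1r.
apply: (@bounded_powers _ (K' / (`|mu| * (`|w| / r) ^+ n0))).
  by rewrite divr_ge0 // ltW.
move=> n; rewrite ler_pdivlMr ?mulr_gt0 ?exprn_gt0 ?divr_gt0 //.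
have := le_n (n + n0)%N (leq_addl _ _).
rewrite -ler_pdivrMr ?exprn_gt0 // -mulrA -expr_div_n; apply: le_trans.
by rewrite mulrCA -exprD.
Qed.

(** * Weil's bound *)

Definition mult_char (F : fieldType) (chi : F -> algC) :=
  [/\ chi 0 = 0, chi 1 = 1 & {morph chi : x y / x * y}].

Section MultiplicativeCharacter.

Variables (F : finFieldType) (chi : F -> algC).
Hypothesis chiP : mult_char chi.

Lemma mult_charX x n : chi (x ^+ n) = chi x ^+ n.
Proof.
case: chiP => _ chi1 chiM; elim: n => [|n IHn]; first by rewrite !expr0.
by rewrite !exprS chiM IHn.
Qed.

Lemma mult_char_norm x : `|chi x| = (x != 0)%:R.
Proof.
case: chiP => chi0 chi1 chiM.
have [->|x_neq0] := eqVneq x 0; first by rewrite chi0 normr0.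
have q_gt1 := finNzRing_gt1 F; have q1_gt0 : (0 < #|F|.-1)%N by rewrite -ltnS prednK // ltnW.
apply/eqP; rewrite -(pexpr_eq1 q1_gt0) // -normrX -mult_charX.
have -> : x ^+ #|F|.-1 = 1.
  by apply: (mulfI x_neq0); rewrite -exprS prednK ?expf_card ?mulr1 // ltnW.
by rewrite chi1 normr1.
Qed.

Lemma mult_char_sum u : u != 0 -> chi u != 1 -> \sum_(y : F) chi y = 0.
Proof.
case: chiP => chi0 chi1 chiM u_neq0 chiu.
have : chi u * \sum_(y : F) chi y = \sum_(y : F) chi y.
  rewrite mulr_sumr [RHS](reindex_inj (mulfI u_neq0)).
  by apply: eq_bigr => y _; rewrite chiM.
by move/eqP; rewrite -subr_eq0 -{2}[\sum_y _]mul1r -mulrBl mulf_eq0 subr_eq0 (negPf chiu) => /eqP.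
Qed.

End MultiplicativeCharacter.

Section Weil.

Variables (F : finFieldType) (chi : F -> algC) (u b1 : F) (bs : seq (F * nat)).
Hypotheses (chiP : mult_char chi) (u_neq0 : u != 0) (chi_u : chi u != 1).
Hypothesis b1_bs : b1 \notin unzip1 bs.

Let q := #|F|.
(** Multiplicative in [h], and equal at ['X - x%:P] to the argument of [chi] in Weil's bound. Thus
    the character sum is the linear coefficient of the L-function. *)
Let val_at (h : {poly F}) := h.[b1] * \prod_(b <- bs) h.[b.1] ^+ b.2.
Let Lam h := chi (val_at h).

Let LamM : {morph Lam : P Q / P * Q}.
Proof.
case: chiP => _ _ chiM P Q; rewrite /Lam -chiM /val_at hornerM.
under eq_bigr do rewrite hornerM exprMn.
by rewrite big_split /=; congr chi; ring.
Qed.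

Let Lam1 : Lam 1 = 1.
Proof.
case: chiP => _ chi1 _; rewrite /Lam /val_at hornerC mul1r big1 // => b _.
by rewrite hornerC expr1n.
Qed.

(** The polynomial [l] vanishes at every shift of [bs] but not at [b1], and its degree is below [n].
    Adding a suitable multiple of it permutes the monic polynomials of degree [n], multiplies the
    value at [b1] by [u] and keeps the other values; so the sum equals [chi u] times itself. *)
Let coef_L_eq0 n : (size bs < n)%N -> coef_L Lam n = 0.
Proof.
case: chiP => _ _ chiM lt_n; pose l := \prod_(b <- unzip1 bs) ('X - b%:P).
have lb1 : l.[b1] != 0 by rewrite -rootE root_prod_XsubC.
pose twist (v : F) (h : {poly F}) := h + ((v - 1) * h.[b1] / l.[b1]) *: l.
have twist_b1 v h : (twist v h).[b1] = v * h.[b1].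
  by rewrite /twist !hornerE divfK //; ring.
have twistK : cancel (twist u) (twist u^-1).
  move=> h; rewrite {1}/twist twist_b1 /twist -addrA -scalerDl.
  rewrite [X in X *: _](_ : _ = 0) ?scale0r ?addr0 //.
  by field; rewrite lb1 u_neq0.
have twist_monic v h : h \in monics F n -> twist v h \in monics F n.
  rewrite !mem_monics => /andP[mon_h /eqP sh].
  have lt_sz : (size (((v - 1) * h.[b1] / l.[b1]) *: l) < size h)%N.
    by rewrite (leq_ltn_trans (size_scale_leq _ _)) // size_prod_XsubC size_map sh ltnS.
  by rewrite monicE lead_coefDl // size_polyDl // sh eqxx andbT -monicE.
have perm_twist : perm_eq (map (twist u) (monics F n)) (monics F n).
  apply: uniq_perm; rewrite ?(map_inj_uniq (can_inj twistK)) ?monics_uniq //.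
  apply: (uniq_min_size _ _ _).2; rewrite ?(map_inj_uniq (can_inj twistK)) ?monics_uniq ?size_map //.
  by move=> _ /mapP[h hm ->]; apply: twist_monic.
have : chi u * coef_L Lam n = coef_L Lam n.
  rewrite /coef_L -[RHS](perm_big _ perm_twist) [RHS]big_map mulr_sumr.
  apply: eq_bigr => h _; rewrite /Lam -chiM /val_at twist_b1 -mulrA; congr chi.
  congr (_ * (_ * _)); apply: eq_big_seq => b b_bs.
  rewrite /twist !hornerE; have /rootP -> : root l b.1 by rewrite root_prod_XsubC map_f.
  by rewrite mulr0 addr0.
by move/eqP; rewrite -subr_eq0 -{2}[coef_L _ _]mul1r -mulrBl mulf_eq0 subr_eq0 (negPf chi_u) => /eqP.
Qed.

(** The power sum is [\sum_y chi y * #|Z y|] over the fibres of a norm. Each fibre has at most [U]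
    elements, and since the fibres over [y != 0] miss at most [m] of the [r ^ 2] elements of [E],
    the defects [U - #|Z y|] add up to [O(r)]. As [chi] has sum 0, the fibre sizes may be replaced
    by minus these defects. The condition [2 < n] ensures [4 < r]. *)
Let power_sum_bound n : (2 < n)%N ->
  `|power_sum_L Lam (2 * n)| <=
    (q * (3 * (\sum_(b <- bs) b.2).+1 + 1) + (\sum_(b <- bs) b.2).+1)%:R * q%:R ^+ n.
Proof.
case: (chiP) => chi0 _ _ n_gt2; have n_gt0 : (0 < 2 * n)%N by lia.
have [E [emb card_E]] := finField_extension F n_gt0.
have q_gt1 : (1 < q)%N := finNzRing_gt1 F.
have q_gt0 : (0 < q)%N := ltnW q_gt1.
set m := (\sum_(b <- bs) b.2).+1.
(* With [r.-1 = q.-1 * e'], the exponent [r.+1 * e'] is that of the norm to [F], in the form which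
   Stepanov's bound needs for [d = q.-1]. *)
pose r := (q ^ n)%N; pose e' := (\sum_(i < n) q ^ i)%N.
have rE : r = (q.-1 * e').+1 by rewrite -predn_exp prednK ?expn_gt0 ?q_gt0.
have normE : (\sum_(i < 2 * n) q ^ i = r.+1 * e')%N.
  have /eqP : (q.-1 * \sum_(i < 2 * n) q ^ i = q.-1 * (r.+1 * e'))%N.
    rewrite -predn_exp mulnC expnM -/(q ^ n)%N.
    have -> : (q.-1 * (r.+1 * e') = r.+1 * r.-1)%N by rewrite rE /=; ring.
    by rewrite -subn1 -(exp1n 2) subn_sqr mulnC subn1 addn1.
  by rewrite eqn_pmul2l ?(eqP _) //; [move/eqP|rewrite -ltnS prednK].
(* The substitution of [emb b1 - x] for the variable moves the isolated shift to 0, where [f] has a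
   simple zero. *)
pose g : {poly E} := \prod_(b <- bs) ('X + (emb (b.1 - b1))%:P) ^+ b.2.
pose f := 'X * g.
have g0 : g.[0] != 0.
  rewrite horner_prod prodf_seq_neq0; apply/allP => b b_bs /=.
  rewrite !hornerE expf_neq0 // fmorph_eq0 subr_eq0.
  by apply: contraNneq b1_bs => <-; apply: map_f.
have size_g : (size g <= m)%N.
  rewrite /g /m; elim: (bs) => [|b s IHs]; first by rewrite big_nil size_poly1.
  rewrite !big_cons; apply: leq_trans (size_polyMleq _ _) _.
  have := size_poly_exp_leq ('X + (emb (b.1 - b1))%:P) b.2.
  by rewrite size_XaddC mul1n; lia.
have size_f : (size f <= m.+1)%N.
  by apply: leq_trans (size_polyMleq _ _) _; rewrite size_polyX.
pose Z y := [set x | f.[x] ^+ (r.+1 * e') == emb y].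
pose U := (e' * r + (3 * m + 1) * r)%N.
have Z_le y : y != 0 -> (#|Z y| <= U)%N.
  move=> y_neq0; have [p p_pr charF] := finPcharP F.
  have qE : q = (p ^ logn p q)%N by exact: (card_pprimeChar charF).
  apply: (@stepanov_bound E p r q.-1 e' m f g) => //.
  - by rewrite (fmorph_pchar emb).
  - by rewrite /r qE -expnM pnatX pnat_id.
  - by rewrite card_E -expnM mulnC.
  - rewrite (@leq_trans (2 ^ 3)) // (@leq_trans (q ^ 3)) ?leq_exp2r //.
    by rewrite leq_pexp2l.
  - by rewrite fmorph_eq0.
(* The default value contributes nothing, since [chi 0 = 0]. *)
pose pinv z : F := odflt 0 [pick y | emb y == z].
have pinvK y : pinv (emb y) = y.
  rewrite /pinv; case: pickP => [y' /eqP /fmorph_inj //|/(_ y)].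
  by rewrite eqxx.
have -> : power_sum_L Lam (2 * n) = \sum_(y : F) chi y * #|Z y|%:R.
  rewrite -(@sum_over_minimal_polynomials F E emb _ n_gt0 card_E _ Lam
    (fun x => chi (pinv (f.[emb b1 - x] ^+ (r.+1 * e'))))); last first.
    move=> s P x Ps Px; rewrite -normE /Lam -mult_charX // -[in RHS](pinvK (_ ^+ _)).
    congr (chi (pinv _)); rewrite /f hornerM hornerX /g horner_prod exprMn.
    rewrite (norm_root n_gt0 card_E _ Ps Px) /val_at exprMn rmorphM /=; congr (_ * _).
    rewrite -prodrXl -prodrXl rmorph_prod; apply: eq_bigr => b _ /=.
    rewrite horner_exp hornerD hornerX hornerC rmorphB.
    have -> : emb b1 - x + (emb b.1 - emb b1) = emb b.1 - x by ring.
    by rewrite exprAC (norm_root n_gt0 card_E _ Ps Px) -rmorphXn exprAC.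
  rewrite (reindex_inj (inj_comp (addrI (emb b1)) oppr_inj)) /=.
  transitivity (\sum_z \sum_(y | f.[z] ^+ (r.+1 * e') == emb y) chi y).
    apply: eq_bigr => z _; rewrite [emb b1 - _](_ : _ = z); last by rewrite /=; ring.
    rewrite /pinv; case: pickP => [y /eqP yE|no_y] /=; last first.
      by rewrite chi0 big_pred0 // => y; rewrite eq_sym no_y.
    rewrite (big_pred1 y) // => y' /=; rewrite -yE.
    by rewrite (inj_eq (fmorph_inj emb)) eq_sym.
  rewrite (exchange_big_dep xpredT) //=; apply: eq_bigr => y _.
  by rewrite sumr_const mulr_natr cardsE.
have sum_chi : \sum_(y : F) chi y = 0 by apply: mult_char_sum chi_u.
have -> : \sum_(y : F) chi y * #|Z y|%:R = - \sum_(y : F | y != 0%R) chi y * (U%:R - #|Z y|%:R).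
  have -> : \sum_(y : F | y != 0%R) chi y * (U%:R - #|Z y|%:R) = \sum_(y : F) chi y * (U%:R - #|Z y|%:R).
    by rewrite [RHS](bigD1 0) //= chi0 mul0r add0r.
  under [in RHS]eq_bigr do rewrite mulrBr.
  by rewrite sumrB -mulr_suml sum_chi mul0r sub0r opprK.
have sum_Z : (r ^ 2 <= \sum_(y : F | y != 0%R) #|Z y| + m)%N.
  have f_neq0 : f != 0.
    rewrite mulf_neq0 ?polyX_eq0 //; apply: contraNneq g0 => ->.
    by rewrite horner0.
  pose Z0 := [set x | f.[x] == 0].
  have Z0_le : (#|Z0| <= m)%N.
    rewrite -ltnS; apply: leq_trans size_f; rewrite cardE.
    apply: max_poly_roots; rewrite ?enum_uniq //.
    by apply/allP => x; rewrite mem_enum inE.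
  have : (r ^ 2 <= \sum_(y : F | y != 0%R) #|Z y| + #|Z0|)%N.
    have cardZ (A : {set E}) : #|A| = (\sum_(z : E) (z \in A))%N.
      by rewrite -sum1_card big_mkcond; apply: eq_bigr => z _; case: (z \in A).
    under eq_bigr do rewrite cardZ.
    rewrite exchange_big /= cardZ -big_split /=.
    have -> : (r ^ 2 = \sum_(z : E) 1)%N by rewrite sum1_card card_E -expnM mulnC.
    apply: leq_sum => z _; rewrite inE; have [//|fz0] := eqVneq f.[z] 0.
      by rewrite addn1.
    (* Multiplying the norm exponent by [q] adds [(q ^ (2 * n)).-1], the order of the unit group of
       [E]. So the value is fixed by the Frobenius map of [F]. *)
    have [y yE] : exists y, f.[z] ^+ (r.+1 * e') = emb y.
      apply: frobenius_fixed. rewrite -exprM -normE.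
      have -> : ((\sum_(i < 2 * n) q ^ i) * q = \sum_(i < 2 * n) q ^ i + (q ^ (2 * n)).-1)%N.
        by rewrite predn_exp; move: (\sum_(_ < _) _)%N => S; rewrite mulnC -{1}(prednK q_gt0) mulSn.
      have fzX : f.[z] ^+ (q ^ (2 * n)).-1 = 1.
        apply: (mulfI fz0); rewrite -exprS prednK ?expn_gt0 ?q_gt0 //.
        by rewrite -card_E expf_card mulr1.
      by rewrite exprD fzX mulr1.
    rewrite addn0 (bigD1 y) /= ?inE ?yE ?eqxx //.
    by apply: contraNneq (expf_neq0 (r.+1 * e') fz0) => y0; rewrite yE y0 rmorph0.
  by move/leq_trans; apply; rewrite leq_add2l.
rewrite normrN (le_trans (ler_norm_sum _ _ _)) //.
have -> : \sum_(y : F | y != 0%R) `|chi y * (U%:R - #|Z y|%:R)| =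
    (\sum_(y : F | y != 0%R) (U - #|Z y|))%:R.
  rewrite natr_sum; apply: eq_bigr => y y_neq0.
  by rewrite normrM mult_char_norm // y_neq0 mul1r -natrB ?Z_le // normr_nat.
rewrite -natrX -natrM ler_nat.
have sum_U : (\sum_(y : F | y != 0%R) (U - #|Z y|) + \sum_(y : F | y != 0%R) #|Z y| = q.-1 * U)%N.
  rewrite -big_split (eq_bigr (fun=> U)) => [|y y_neq0]; last exact: subnK (Z_le y y_neq0).
  rewrite sum_nat_const; congr (_ * _)%N.
  by rewrite -(cardC1 (0 : F)); apply: eq_card.
have : (q.-1 * U = r * r.-1 + q.-1 * ((3 * m + 1) * r))%N by rewrite /U rE /=; ring.
have : (q.-1 * ((3 * m + 1) * r) <= q * (3 * m + 1) * r)%N.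
  by rewrite mulnA leq_mul2r leq_mul2r leq_pred orbT orbT.
have : (m <= m * r)%N by rewrite leq_pmulr // rE.
have : (r * r.-1 <= r ^ 2)%N by rewrite leq_mul2l leq_pred orbT.
have -> : ((q * (3 * m + 1) + m) * q ^ n = q * (3 * m + 1) * r + m * r)%N by rewrite mulnDl.
move: sum_Z sum_U.
move: (\sum_(y | _) #|Z y|)%N (\sum_(y | _) (U - #|Z y|))%N (q.-1 * U)%N.
move: (q.-1 * _)%N (q * _ * r)%N (r * _)%N (r ^ 2)%N (m * r)%N => *; lia.
Qed.

(** By Newton's identity in degree 1 the sum is minus the sum of the inverse roots of the
    L-function, of which there are at most [size bs]. *)
Theorem weil_bound :
  `|\sum_x chi ((b1 - x) * \prod_(b <- bs) (b.1 - x) ^+ b.2)| <=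
    (size bs)%:R * sqrtC q%:R.
Proof.
have q_gt0 : 0 < q%:R :> algC by rewrite ltr0n; apply: ltnW (finNzRing_gt1 F).
have c0 : coef_L Lam 0 = 1.
  have mon0 : monics F 0 =i [:: 1].
    move=> h; rewrite mem_monics inE; apply/andP/eqP => [[mon_h /eqP sh]|->].
      by apply/eqP; rewrite -eqp_monic ?monic1 // -size_poly_eq1 sh.
    by rewrite monic1 size_poly1.
  have perm0 : perm_eq (monics F 0) [:: 1] by apply: uniq_perm; rewrite ?monics_uniq.
  by rewrite /coef_L (perm_big _ perm0) big_seq1 Lam1.
have c1 : coef_L Lam 1 = \sum_x chi ((b1 - x) * \prod_(b <- bs) (b.1 - x) ^+ b.2).
  have mon1 : monics F 1 =i [seq 'X - x%:P | x : F].
    move=> h; rewrite mem_monics; apply/andP/mapP => [[mon_h /eqP sh]|[x _ ->]].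
      exists (- h`_0); rewrite ?mem_enum // polyCN opprK.
      apply/polyP => -[|[|i]]; rewrite coefD coefX coefC /= ?add0r ?addr0 //.
        by move: mon_h; rewrite monicE /lead_coef sh /= => /eqP.
      by rewrite nth_default ?sh.
    by rewrite monicXsubC size_XsubC.
  have perm1 : perm_eq (monics F 1) [seq 'X - x%:P | x : F].
    apply: uniq_perm; rewrite ?monics_uniq // map_inj_uniq ?enum_uniq // => x y.
    by move/addrI/oppr_inj/polyC_inj.
  rewrite /coef_L (perm_big _ perm1) big_map big_enum /=; apply: eq_bigr => x _.
  rewrite /Lam /val_at !hornerE; congr (chi (_ * _)).
  by apply: eq_bigr => b _; rewrite !hornerE.
have [ws size_ws wsE] := @power_sums_of_polynomial_L _ (size bs).+1 (coef_L Lam)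
  (power_sum_L Lam) c0 coef_L_eq0 (fun n => newton_L n LamM Lam1).
have ws_le w : w \in ws -> `|w| <= sqrtC q%:R.
  move=> w_ws; rewrite -(@ler_pXn2r _ 2) // ?nnegrE ?sqrtC_ge0 ?ler0n // sqrtCK -normrX.
  pose K : algC := (q * (3 * (\sum_(b <- bs) b.2).+1 + 1) + (\sum_(b <- bs) b.2).+1)%:R.
  (* Only extensions of even degree are controlled, so the growth argument is applied to the squares
     of the inverse roots, with ratio [q]. *)
  apply: (@power_sum_growth [seq w ^+ 2 | w <- ws] K _ 3 q_gt0); last exact: map_f.
  move=> n lt_n; have n_gt0 : (0 < 2 * n)%N by lia.
  rewrite big_map; apply: le_trans (power_sum_bound lt_n).
  rewrite wsE // normrN le_eqVlt; apply/orP; left; apply/eqP; congr `|_|.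
  by apply: eq_bigr => v _; rewrite exprM.
have <- : power_sum_L Lam 1 = \sum_x chi ((b1 - x) * \prod_(b <- bs) (b.1 - x) ^+ b.2).
  have := newton_L 1 LamM Lam1; rewrite big_nat1 subnn c0 mulr1 mul1r => <-.
  exact: c1.
rewrite wsE // normrN (le_trans (ler_norm_sum _ _ _)) //.
apply: le_trans (_ : \sum_(w <- ws) sqrtC q%:R <= _).
  rewrite big_seq_cond [leRHS]big_seq_cond; apply: ler_sum => w /andP[w_ws _].
  by rewrite expr1 ws_le.
rewrite big_const_seq count_predT iter_addr_0 -[leLHS]mulr_natl.
by rewrite ler_wpM2r ?sqrtC_ge0 ?ler0n // ler_nat.
Qed.

End Weil.

(** * Karatsuba's bound *)

(** Hoelder's inequality for an integer exponent; each induction step is Chebyshev's sum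
    inequality. *)
Lemma power_mean (I : finType) (A : {set I}) (t : I -> algC) n :
  (forall i, 0 <= t i) ->
  (\sum_(i in A) t i) ^+ n.+1 <= #|A|%:R ^+ n * \sum_(i in A) t i ^+ n.+1.
Proof.
move=> t_ge0; elim: n => [|n IHn]; first by rewrite expr0 mul1r expr1.
pose T k := \sum_(i in A) t i ^+ k.
have T_ge0 k : 0 <= T k by apply: sumr_ge0 => i _; rewrite exprn_ge0.
have sum_ge0 : 0 <= \sum_(i in A) t i by apply: sumr_ge0.
have chebyshev : T n.+1 * \sum_(i in A) t i <= #|A|%:R * T n.+2.
  have mono x y : 0 <= x -> 0 <= y -> 0 <= (x ^+ n.+1 - y ^+ n.+1) * (x - y) :> algC.
    move=> x_ge0 y_ge0; have xR := ger0_real x_ge0; have yR := ger0_real y_ge0.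
    case/orP: (real_leVge xR yR) => le_xy.
      rewrite -mulrNN !opprB mulr_ge0 ?subr_ge0 // lerXn2r ?nnegrE //.
    by rewrite mulr_ge0 ?subr_ge0 // lerXn2r ?nnegrE.
  have : 0 <= \sum_(i in A) \sum_(j in A) (t i ^+ n.+1 - t j ^+ n.+1) * (t i - t j).
    by apply: sumr_ge0 => i _; apply: sumr_ge0 => j _; apply: mono.
  have -> : \sum_(i in A) \sum_(j in A) (t i ^+ n.+1 - t j ^+ n.+1) * (t i - t j) =
    2%:R * (#|A|%:R * T n.+2 - T n.+1 * \sum_(i in A) t i).
    transitivity (\sum_(i in A) (#|A|%:R * t i ^+ n.+2 + T n.+2
        - t i ^+ n.+1 * (\sum_(j in A) t j) - T n.+1 * t i)).
      apply: eq_bigr => i _; rewrite mulr_sumr mulr_suml.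
      rewrite (_ : #|A|%:R * _ = \sum_(j in A) t i ^+ n.+2); last first.
        by rewrite sumr_const mulr_natl.
      rewrite -big_split -!sumrB /=; apply: eq_bigr => j _.
      by rewrite [t i ^+ n.+2]exprSr [t j ^+ n.+2]exprSr; ring.
    rewrite !sumrB big_split /= -mulr_sumr -mulr_suml -mulr_sumr sumr_const -/(T _).
    by rewrite -[T n.+2 *+ _]mulr_natl -/(T n.+1); ring.
  by rewrite pmulr_rge0 ?ltr0n // subr_ge0.
rewrite exprSr; apply: le_trans (ler_wpM2r sum_ge0 IHn) _.
by rewrite -mulrA exprSr -mulrA ler_wpM2l ?exprn_ge0 ?ler0n.
Qed.

(** With this flag the [2 * k] factors of [z ^+ k * z^* ^+ k] are indexed uniformly by
    ['I_k * bool]. *)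
Definition conj_if (b : bool) (z : algC) := if b then z^* else z.

Lemma conj_ifM b : {morph conj_if b : x y / x * y}.
Proof. by case: b => x y //=; rewrite rmorphM. Qed.

Lemma conj_if_norm b z : `|conj_if b z| = `|z|.
Proof. by case: b; rewrite /= ?norm_conjC. Qed.

(** If every value is taken at least twice, there are at most [k] values, so the map factors through
    ['I_k]. *)
Lemma card_without_isolated_values (J : finType) (T : finType) (B : {set T}) k :
  (0 < k)%N -> #|J| = (2 * k)%N ->
  (#|[set v : {ffun J -> T} | [forall j, v j \in B] &&
       [forall j0, exists j, (j != j0) && (v j == v j0)]]|
     <= k ^ (2 * k) * #|B| ^ k)%N.
Proof.
move=> k_gt0 cardJ.
pose S := [set psi : {ffun 'I_k -> T} | [forall i, psi i \in B]].
pose comp (p : {ffun J -> 'I_k} * {ffun 'I_k -> T}) := [ffun j => p.2 (p.1 j)].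
have card_pairs : #|setX [set: {ffun J -> 'I_k}] S| = (k ^ (2 * k) * #|B| ^ k)%N.
  rewrite cardsX cardsT card_ffun card_ord cardJ; congr (_ * _)%N.
  rewrite -[k in RHS](card_ord k) -card_ffun_on; apply: eq_card => psi.
  by rewrite inE; apply/forallP/ffun_onP.
rewrite -card_pairs; apply: leq_trans (leq_imset_card comp _).
apply: subset_leq_card; apply/subsetP => v; rewrite inE => /andP[/forallP vB /forallP v2].
pose im := [set v j | j in J].
have card_im : (#|im| <= k)%N.
  rewrite -(leq_pmul2l (isT : (0 < 2)%N)) -cardJ -[leqRHS]sum1_card.
  have -> : (\sum_(j in J) 1 = \sum_(y in im) \sum_(j | v j == y) 1)%N.
    by rewrite (partition_big v (fun y => y \in im)) //= => j _; apply: imset_f.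
  rewrite mulnC -sum_nat_const; apply: leq_sum => y /imsetP[j0 _ ->].
  have [j /andP[ne_j /eqP eq_v]] := existsP (v2 j0).
  by rewrite (bigD1 j0) //= (bigD1 j) ?eq_v ?eqxx ?ne_j.
have [j1 _] : exists j : J, true.
  by have /card_gt0P[j _] : (0 < #|J|)%N; [rewrite cardJ muln_gt0|exists j].
pose idx j := index (v j) (enum im).
have idx_lt j : (idx j < k)%N.
  apply: leq_trans card_im; rewrite cardE index_mem mem_enum.
  exact: imset_f.
apply/imsetP.
(* When [v] takes fewer than [k] values, the free places are filled with [v j1], which lies in
   [B]. *)
exists ([ffun j => Ordinal (idx_lt j)], [ffun i : 'I_k => nth (v j1) (enum im) i]).
  rewrite !inE /=; apply/forallP => i; rewrite ffunE.
  have [lt_i|le_i] := ltnP i (size (enum im)); last by rewrite nth_default.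
  by have := mem_nth (v j1) lt_i; rewrite mem_enum => /imsetP[j _ ->].
by apply/ffunP => j; rewrite !ffunE /= nth_index // mem_enum imset_f.
Qed.

Section Karatsuba.

Variables (F : finFieldType) (chi : F -> algC) (u : F).
Hypotheses (chiP : mult_char chi) (u_neq0 : u != 0) (chi_u : chi u != 1).

Let q := #|F|.

(** Conjugate factors thereby become factors of higher multiplicity in Weil's bound. At [y = 0] this
    uses [2 < q], which the nontriviality of [chi] forces. *)
Lemma conj_mult_char y : (chi y)^* = chi (y ^+ (q - 2)).
Proof.
case: (chiP) => chi0 chi1 chiM; have q_gt1 := finNzRing_gt1 F.
have q_gt2 : (2 < q)%N.
  rewrite ltn_neqAle q_gt1 andbT; apply: contraNneq chi_u => q2.
  suff -> : u = 1 by rewrite chi1.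
  have := expf_card u; rewrite -[#|F|]/q -q2 expr2 -{3}[u]mulr1.
  exact: mulfI.
have [->|y_neq0] := eqVneq y 0.
  by rewrite expr0n subn_eq0 leqNgt q_gt2 chi0 rmorph0.
have norm_y : `|chi y| = 1 by rewrite mult_char_norm // y_neq0.
have chiy_neq0 : chi y != 0 by rewrite -normr_eq0 norm_y oner_eq0.
apply: (mulfI chiy_neq0); rewrite -normCK norm_y expr1n -chiM -exprS.
have -> : y ^+ (q - 2).+1 = 1.
  apply: (mulfI y_neq0); rewrite -exprS mulr1 -[RHS]expf_card.
  by congr (_ ^+ _); rewrite -/q; lia.
by rewrite chi1.
Qed.

Lemma isolated_shift_bound (J : finType) (sigma : J -> bool) (v : J -> F) j0 :
  (forall j, j != j0 -> v j != v j0) ->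
  `|\sum_x \prod_j conj_if (sigma j) (chi (x + v j))| <= #|J|%:R * sqrtC q%:R.
Proof.
(* Conjugating the whole sum flips all flags and keeps the modulus; so the isolated factor can be
   given multiplicity one instead of [q - 2]. *)
wlog sigma_j0 : sigma / sigma j0 = false => [wl iso_j0|iso_j0].
  case sj0: (sigma j0); last exact: wl.
  rewrite -norm_conjC rmorph_sum /=.
  under eq_bigr do rewrite rmorph_prod /=.
  have -> : \sum_x \prod_j (conj_if (sigma j) (chi (x + v j)))^* =
            \sum_x \prod_j (conj_if (~~ sigma j) (chi (x + v j))).
    apply: eq_bigr => x _; apply: eq_bigr => j _.
    by case: (sigma j); rewrite /= ?conjCK.
  by apply: wl => //; rewrite sj0.
case: (chiP) => chi0 chi1 chiM.
pose bs := [seq (v j, if sigma j then (q - 2)%N else 1%N) | j <- enum J & j != j0].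
have b1_bs : v j0 \notin unzip1 bs.
  apply/mapP => -[b /mapP[j]]; rewrite mem_filter => /andP[ne_j _] -> /= eq_v.
  by have := iso_j0 j ne_j; rewrite eq_v eqxx.
have := weil_bound chiP u_neq0 chi_u b1_bs.
have -> : \sum_x chi ((v j0 - x) * \prod_(b <- bs) (b.1 - x) ^+ b.2) =
    \sum_x \prod_j conj_if (sigma j) (chi (x + v j)).
  rewrite (reindex_inj oppr_inj) /=; apply: eq_bigr => x _.
  rewrite chiM opprK [v j0 + x]addrC [RHS](bigD1 j0) //= sigma_j0; congr (_ * _).
  rewrite big_map big_filter big_enum_cond /=.
  rewrite (big_morph chi chiM chi1); apply: eq_bigr => j _.
  rewrite [v j + x]addrC; case: (sigma j) => /=; last by rewrite expr1.
  by rewrite conj_mult_char.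
move/le_trans; apply; rewrite ler_wpM2r ?sqrtC_ge0 ?ler0n // ler_nat.
by rewrite size_map size_filter (leq_trans (count_size _ _)) // -cardE.
Qed.

Lemma karatsuba_bound (A B : {set F}) (w : F -> algC) k : (0 < k)%N ->
  (forall b, `|w b| <= 1) ->
  `|\sum_(a in A) \sum_(b in B) w b * chi (a + b)| ^+ (2 * k) <=
    #|A|%:R ^+ (2 * k).-1 *
    ((k ^ (2 * k) * #|B| ^ k * q)%:R + (2 * k * #|B| ^ (2 * k))%:R * sqrtC q%:R).
Proof.
move=> k_gt0 w_le1; pose z x := \sum_(b in B) w b * chi (x + b).
have k2E : (2 * k = (2 * k).-1.+1)%N by rewrite prednK // muln_gt0.
apply: le_trans (_ : (\sum_(a in A) `|z a|) ^+ (2 * k) <= _).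
  by rewrite lerXn2r ?nnegrE ?sumr_ge0 // ler_norm_sum.
rewrite [in leLHS]k2E; apply: le_trans (power_mean _ _ _) _ => //.
rewrite -k2E ler_wpM2l ?exprn_ge0 ?ler0n //.
(* The added terms are nonnegative, and over the whole field the expansion yields complete sums,
   within reach of Weil's bound. *)
apply: le_trans (_ : \sum_x `|z x| ^+ (2 * k) <= _).
  rewrite [leRHS](bigID (mem A)) /= lerDl sumr_ge0 // => x _.
  by rewrite exprn_ge0.
pose J : finType := ('I_k * bool)%type.
have cardJ : #|J| = (2 * k)%N by rewrite card_prod card_ord card_bool mulnC.
pose X (v : J -> F) := \sum_x \prod_(j : J) conj_if j.2 (chi (x + v j)).
pose W (v : J -> F) := \prod_(j : J) conj_if j.2 (w (v j)).
have W_le v : `|W v| <= 1.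
  rewrite normr_prod; apply: prodr_ile1 => j _.
  by rewrite normr_ge0 conj_if_norm w_le1.
have zE x : `|z x| ^+ (2 * k) =
    \sum_(v in ffun_on (mem B)) \prod_(j : J) conj_if j.2 (w (v j) * chi (x + v j)).
  rewrite exprM normCK.
  transitivity (\prod_(j : J) \sum_(b in B) conj_if j.2 (w b * chi (x + b))).
    rewrite -(pair_bigA _ (fun (i : 'I_k) s => \sum_(b in B) conj_if s (w b * chi (x + b)))) /=.
    rewrite prodr_const card_ord; congr (_ ^+ _).
    by rewrite big_bool /= mulrC /z rmorph_sum.
  by rewrite bigA_distr_big.
have X_le_q v : `|X v| <= q%:R.
  apply: le_trans (ler_norm_sum _ _ _) _.
  rewrite (_ : q%:R = \sum_(x : F) 1); last by rewrite sumr_const.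
  apply: ler_sum => x _; rewrite normr_prod; apply: prodr_ile1 => j _.
  by rewrite normr_ge0 conj_if_norm mult_char_norm // lern1 leq_b1.
have sumE : \sum_x `|z x| ^+ (2 * k) = \sum_(v in ffun_on (mem B)) W v * X v.
  under eq_bigr do rewrite zE.
  rewrite exchange_big /=; apply: eq_bigr => v _; rewrite /X mulr_sumr.
  apply: eq_bigr => x _; rewrite -big_split /=; apply: eq_bigr => j _.
  exact: conj_ifM.
have sum_ge0 : 0 <= \sum_x `|z x| ^+ (2 * k).
  by apply: sumr_ge0 => x _; rewrite exprn_ge0.
rewrite -(ger0_norm sum_ge0) sumE; apply: le_trans (ler_norm_sum _ _ _) _.
pose bad (v : {ffun J -> F}) := [forall j0, exists j, (j != j0) && (v j == v j0)].
apply: le_trans (_ : \sum_(v in ffun_on (mem B))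
    ((bad v)%:R * q%:R + (2 * k)%:R * sqrtC q%:R) <= _).
  apply: ler_sum => v _; rewrite normrM.
  apply: le_trans (_ : `|X v| <= _); first by rewrite ler_piMl.
  have s_ge0 : 0 <= (2 * k)%:R * sqrtC q%:R :> algC.
    by rewrite mulr_ge0 ?sqrtC_ge0 ?ler0n.
  have [bad_v|] := boolP (bad v).
    by rewrite mul1r (le_trans (X_le_q v)) // lerDl.
  rewrite negb_forall => /existsP[j0]; rewrite negb_exists => /forallP good_j0.
  rewrite mul0r add0r -cardJ; apply: (@isolated_shift_bound J _ v j0) => j ne_j.
  by have := good_j0 j; rewrite ne_j.
rewrite big_split /= sumr_const -mulr_suml.
rewrite lerD //.
  rewrite -natr_sum -natrM ler_nat leq_mul2r; apply/orP; right.
  apply: leq_trans (card_without_isolated_values B k_gt0 cardJ).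
  rewrite -sum1_card big_mkcond [leqRHS]big_mkcond /=.
  apply: leq_sum => v _.
  rewrite !inE (_ : [forall x, v x \in mem B] = [forall j, v j \in B]) //.
  by case: [forall j, _] => //=; rewrite -/(bad v); case: (bad v).
rewrite card_ffun_on cardJ -[leLHS]mulr_natl [in leRHS]natrM mulrA.
by rewrite [in leLHS](mulrC _ (2 * k)%:R).
Qed.

End Karatsuba.

(** * Counting by characters *)

Lemma cauchy_schwarz (I : finType) (x y : I -> algC) :
  (forall i, 0 <= x i) -> (forall i, 0 <= y i) ->
  (\sum_i x i * y i) ^+ 2 <= (\sum_i x i ^+ 2) * (\sum_i y i ^+ 2).
Proof.
move=> x_ge0 y_ge0.
have real_xy i j : x i * y j \is Num.real by rewrite ger0_real ?mulr_ge0.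
have : 0 <= \sum_i \sum_j (x i * y j - x j * y i) ^+ 2.
  by apply: sumr_ge0 => i _; apply: sumr_ge0 => j _; rewrite -realEsqr rpredB.
have -> : \sum_i \sum_j (x i * y j - x j * y i) ^+ 2 =
    2%:R * ((\sum_i x i ^+ 2) * (\sum_i y i ^+ 2) - (\sum_i x i * y i) ^+ 2).
  transitivity (\sum_i (x i ^+ 2 * (\sum_j y j ^+ 2) + y i ^+ 2 * (\sum_j x j ^+ 2)
      - 2%:R * (x i * y i) * \sum_j x j * y j)).
    apply: eq_bigr => i _; rewrite !mulr_sumr -big_split -sumrB /=.
    by apply: eq_bigr => j _; ring.
  by rewrite sumrB big_split /= -!mulr_suml -mulr_sumr; ring.
by rewrite pmulr_rge0 ?ltr0n // subr_ge0.
Qed.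

Section DualGroup.

Variable F : finFieldType.
Let G := [set: {unit F}]%G.
Let q := #|F|.

Let toU (y : F) : {unit F} := insubd (1%g : {unit F}) y.

(** Extension by zero: at [y = 0] the unit [toU y] is the default [1], masked by the first
    factor. *)
Definition unit_char (i : Iirr G) (y : F) : algC := (y != 0)%:R * 'chi_i (toU y).

Let abelG : abelian G.
Proof. exact/cyclic_abelian/field_unit_group_cyclic. Qed.

Let toUK y : y != 0 -> val (toU y) = y.
Proof. by move=> y_neq0; rewrite insubdK // unfold_in unitfE. Qed.

Let toUM x y : x != 0 -> y != 0 -> toU (x * y) = (toU x * toU y)%g.
Proof.
by move=> x0 y0; apply: val_inj; rewrite toUK ?mulf_neq0 //= !toUK.
Qed.

Let lin_chi (i : Iirr G) : 'chi_i \is a linear_char.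
Proof. exact/char_abelianP. Qed.

Lemma unit_charP i : mult_char (unit_char i).
Proof.
split; first by rewrite /unit_char eqxx mul0r.
  rewrite /unit_char oner_neq0 mul1r (_ : toU 1 = 1%g) ?lin_char1 //.
  by apply: val_inj; rewrite toUK ?oner_neq0.
move=> x y; rewrite /unit_char mulf_eq0 negb_or.
have [->|x0] := eqVneq x 0; first by rewrite !mul0r.
have [->|y0] := eqVneq y 0; first by rewrite !mul0r mulr0.
by rewrite !mul1r toUM // lin_charM ?inE.
Qed.

Lemma unit_char_trivial y : unit_char 0 y = (y != 0)%:R.
Proof. by rewrite /unit_char irr0 cfun1E inE mulr1. Qed.

Lemma unit_char_nontrivial i : i != 0 ->
  exists2 u, u != 0 & unit_char i u != 1.
Proof.
move=> i_neq0; apply/exists_inP; apply: contraR i_neq0.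
rewrite negb_exists_in => /forall_inP chi1; apply/eqP/irr_inj.
rewrite irr0; apply/cfun_inP => g _; rewrite cfun1E inE.
have g_neq0 : val g != 0 :> F by rewrite -unitfE (valP g).
have := chi1 _ g_neq0; rewrite negbK /unit_char g_neq0 mul1r => /eqP <-.
by congr ('chi_i _); apply: val_inj; rewrite toUK.
Qed.

Lemma unit_char_orthogonality x y : y != 0 ->
  \sum_i unit_char i x * (unit_char i y)^* = (q.-1 * (x == y))%:R.
Proof.
move=> y0; have [->|x0] := eqVneq x 0.
  rewrite eq_sym (negPf y0) muln0 big1 // => i _.
  by have [-> _ _] := unit_charP i; rewrite mul0r.
under eq_bigr do rewrite /unit_char x0 y0 !mul1r.
rewrite second_orthogonality_relation ?inE //.
have -> : 'C_G[toU x]%g = G.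
  apply/setIidPl/(subset_trans abelG); rewrite -cent_set1.
  by apply: centS; rewrite sub1set inE.
have -> : (toU x \in (toU y ^: G)%g) = (x == y).
  have conjU g : (toU y ^ g = toU y)%g.
    by apply/conjg_fixP/commgP/(centsP abelG); rewrite inE.
  apply/imsetP/eqP => [[g _]|->]; last by exists 1%g; rewrite ?inE ?conjU.
  by rewrite conjU => eqU; rewrite -(toUK x0) eqU toUK.
rewrite card_finField_unit -/q; case: (x == y); first by rewrite muln1.
by rewrite muln0.
Qed.

Lemma unit_char_parseval (C : {set F}) : 0 \notin C ->
  \sum_i `|\sum_(c in C) unit_char i c| ^+ 2 = (q.-1 * #|C|)%:R.
Proof.
move=> C0.
transitivity (\sum_(c in C) \sum_(d in C)
    \sum_i unit_char i c * (unit_char i d)^*).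
  under [RHS]eq_bigr do rewrite exchange_big /=.
  rewrite exchange_big /=; apply: eq_bigr => i _.
  rewrite normCK rmorph_sum mulr_suml; apply: eq_bigr => c _.
  by rewrite mulr_sumr.
rewrite natrM mulr_natr -sumr_const; apply: eq_bigr => c cC.
have nz d : d \in C -> d != 0 by apply: contraTneq => ->.
rewrite (bigD1 c) //= unit_char_orthogonality ?nz // eqxx muln1.
rewrite big1 ?addr0 // => d /andP[dC ne_dc].
by rewrite unit_char_orthogonality ?nz // eq_sym (negPf ne_dc) muln0.
Qed.

Variables (A B C D : {set F}) (mu : F -> F) (k : nat).
Hypotheses (k_gt0 : (0 < k)%N) (C0 : 0 \notin C) (D0 : 0 \notin D).
Hypothesis mu_neq0 : forall b, b \in B -> mu b != 0.

Let cnt : nat := (\sum_(a in A) \sum_(b in B) \sum_(c in C) \sum_(d in D)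
   (a + b == mu b * (c * d))%R)%N.
Let pairs : nat := (\sum_(a in A) \sum_(b in B) (a + b != 0)%R)%N.
Let sumC i := \sum_(c in C) unit_char i c.
Let sumD i := \sum_(d in D) unit_char i d.
Let sumAB i := \sum_(a in A) \sum_(b in B) (unit_char i (mu b))^* * unit_char i (a + b).

Lemma count_by_characters :
  (q.-1 * cnt)%:R = \sum_i sumAB i * ((sumC i)^* * (sumD i)^*).
Proof.
transitivity (\sum_(a in A) \sum_(b in B) \sum_(c in C) \sum_(d in D)
   \sum_i unit_char i (a + b) * (unit_char i (mu b * (c * d)))^*).
  rewrite natrM natr_sum mulr_sumr; apply: eq_bigr => a _.
  rewrite natr_sum mulr_sumr; apply: eq_bigr => b bB.
  rewrite natr_sum mulr_sumr; apply: eq_bigr => c cC.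
  rewrite natr_sum mulr_sumr; apply: eq_bigr => d dD.
  rewrite unit_char_orthogonality ?natrM // !mulf_neq0 ?mu_neq0 //.
    by apply: contraNneq C0 => <-.
  by apply: contraNneq D0 => <-.
under eq_bigr => a _ do under eq_bigr => b _ do under eq_bigr => c _ do rewrite exchange_big.
under eq_bigr => a _ do under eq_bigr => b _ do rewrite exchange_big.
under eq_bigr => a _ do rewrite exchange_big.
rewrite exchange_big /=; apply: eq_bigr => i _.
rewrite /sumAB mulr_suml; apply: eq_bigr => a _.
rewrite mulr_suml; apply: eq_bigr => b _.
rewrite /sumC rmorph_sum mulr_suml mulr_sumr; apply: eq_bigr => c _.
rewrite /sumD rmorph_sum mulr_sumr mulr_sumr; apply: eq_bigr => d _.
have [_ _ chiM] := unit_charP i.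
by rewrite !chiM !rmorphM /=; ring.
Qed.

(** The trivial character gives the main term. For the others, [M] is the root of Karatsuba's bound,
    and the sums over [C] and [D] are treated by Cauchy-Schwarz and Parseval. The exponent [4 * k]
    clears the [2 * k]-th root in [M] as well as the square roots of [q] and [#|C| * #|D|], so that
    the bound is a natural number. *)
Lemma count_deviation :
  `|(q.-1 * cnt)%:R - (pairs * #|C| * #|D|)%:R| ^+ (4 * k) <=
  (#|A| ^ (2 * (2 * k).-1) *
   (2 * ((k ^ (2 * k) * #|B| ^ k * q) ^ 2 + (2 * k * #|B| ^ (2 * k)) ^ 2 * q)) *
   (q.-1 ^ 2 * (#|C| * #|D|)) ^ (2 * k))%:R :> algC.
Proof.
set N : nat := (#|A| ^ _ * _ * _)%N.
have sumAB0 : sumAB 0 = pairs%:R.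
  rewrite natr_sum; apply: eq_bigr => a _; rewrite natr_sum; apply: eq_bigr => b bB.
  by rewrite !unit_char_trivial mu_neq0 // rmorph1 mul1r.
have sum0 (S : {set F}) : 0 \notin S -> \sum_(c in S) unit_char 0 c = #|S|%:R.
  move=> S0; rewrite -sum1_card natr_sum; apply: eq_bigr => c cS.
  by rewrite unit_char_trivial (_ : c != 0) //; apply: contraNneq S0 => <-.
rewrite count_by_characters (bigD1 0) //= sumAB0 /sumC /sumD !sum0 //.
rewrite !rmorph_nat !natrM mulrA addrAC subrr add0r -/sumC -/sumD.
pose X : algC := (k ^ (2 * k) * #|B| ^ k * q)%:R.
pose Y : algC := (2 * k * #|B| ^ (2 * k))%:R.
pose Q : algC := #|A|%:R ^+ (2 * k).-1 * (X + Y * sqrtC q%:R).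
have k2_gt0 : (0 < 2 * k)%N by rewrite muln_gt0.
have Q_ge0 : 0 <= Q.
  by rewrite mulr_ge0 ?exprn_ge0 ?addr_ge0 ?mulr_ge0 ?sqrtC_ge0 ?ler0n.
pose M := (2 * k).-root Q.
have M_ge0 : 0 <= M by rewrite rootC_ge0.
have sumAB_le i : i != 0 -> `|sumAB i| <= M.
  move=> i_neq0; have [u u_neq0 chi_u] := unit_char_nontrivial i_neq0.
  rewrite -(ler_pXn2r k2_gt0) ?nnegrE // /M rootCK //.
  (* The factor [mu b] enters only through the weights, of modulus at most 1. *)
  apply: (karatsuba_bound (unit_charP i) u_neq0 chi_u A B
    (w := fun b => (unit_char i (mu b))^*) k_gt0) => b.
  by rewrite norm_conjC (mult_char_norm (unit_charP i)) lern1 leq_b1.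
set err := \sum_(i | _) _.
have err_le : `|err| ^+ 2 <= M ^+ 2 * ((q.-1%:R ^+ 2) * (#|C|%:R * #|D|%:R)).
  have : `|err| <= M * \sum_i `|sumC i| * `|sumD i|.
    apply: le_trans (ler_norm_sum _ _ _) _; rewrite mulr_sumr.
    rewrite [leRHS](bigID (fun i => i != 0)) /=.
    apply: le_trans (_ : \sum_(i | i != 0) M * (`|sumC i| * `|sumD i|) <= _).
      apply: ler_sum => i i_neq0; rewrite !normrM !norm_conjC.
      by rewrite ler_wpM2r ?mulr_ge0 ?sumAB_le.
    by rewrite lerDl sumr_ge0 // => i _; rewrite !mulr_ge0.
  move=> err1; apply: le_trans (lerXn2r 2 _ _ err1) _; rewrite ?nnegrE //.
    by rewrite mulr_ge0 // sumr_ge0 // => i _; rewrite mulr_ge0.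
  rewrite exprMn ler_wpM2l ?exprn_ge0 //.
  apply: le_trans (cauchy_schwarz _ _) _ => //.
  by rewrite !unit_char_parseval // !natrM le_eqVlt; apply/orP; left; apply/eqP; ring.
have -> : (4 * k = 2 * (2 * k))%N by rewrite mulnA.
rewrite exprM.
have rhs_ge0 : 0 <= M ^+ 2 * (q.-1%:R ^+ 2 * (#|C|%:R * #|D|%:R)).
  by rewrite !mulr_ge0 ?exprn_ge0 ?ler0n.
apply: le_trans (_ : (M ^+ 2 * (q.-1%:R ^+ 2 * (#|C|%:R * #|D|%:R))) ^+ (2 * k) <= _).
  by rewrite lerXn2r ?nnegrE ?exprn_ge0.
have M2k : (M ^+ 2) ^+ (2 * k) = Q ^+ 2 by rewrite exprAC rootCK.
have Q2_le : Q ^+ 2 <= #|A|%:R ^+ (2 * (2 * k).-1) * (2%:R * (X ^+ 2 + Y ^+ 2 * q%:R)).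
  rewrite exprMn -exprM mulnC ler_wpM2l ?exprn_ge0 ?ler0n //.
  rewrite -[q%:R in leRHS]sqrtCK -exprMn -subr_ge0.
  set Y' := Y * _; have -> : 2%:R * (X ^+ 2 + Y' ^+ 2) - (X + Y') ^+ 2 = (X - Y') ^+ 2 by ring.
  rewrite -realEsqr rpredB // ger0_real ?mulr_ge0 ?sqrtC_ge0 ?ler0n //.
rewrite exprMn M2k ler_pM ?(exprn_ge0 _ Q_ge0) ?exprn_ge0 ?mulr_ge0 ?exprn_ge0 ?ler0n //.
  by rewrite natrX natrD [X in _ + X]natrM !natrX.
by rewrite natrX !natrM -expr2.
Qed.

End DualGroup.

(** * The two equations *)

Section CountingSolutions.

Variable F : finFieldType.
Implicit Types (A B C D : {set F}) (s : F) (mu : F -> F).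

Definition mul_count C D s : nat :=
  (\sum_(c in C) \sum_(d in D) (s == c * d)%R)%N.

(** Characters see only nonzero elements. Discarding zeros matters for [s = 0] alone, where the
    solutions lie on the two coordinate axes. *)
Lemma mul_count_nonzero C D s :
  (mul_count (C :\ 0%R) (D :\ 0%R) s <= mul_count C D s
     <= mul_count (C :\ 0%R) (D :\ 0%R) s + (s == 0)%R * (2 * #|F|))%N.
Proof.
have nzE : mul_count (C :\ 0%R) (D :\ 0%R) s =
    (\sum_(c in C) \sum_(d in D) ((s == c * d)%R && (s != 0)%R))%N.
  rewrite /mul_count big_mkcond [RHS]big_mkcond; apply: eq_bigr => c _ /=.
  rewrite !inE; have [->|c0] := eqVneq c 0.
    case: (_ \in C); rewrite //= big1 // => d _.
    by rewrite mul0r; case: eqP.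
  case: (c \in C) => //=; rewrite big_mkcond [RHS]big_mkcond; apply: eq_bigr => d _ /=.
  rewrite !inE; have [->|d0] := eqVneq d 0.
    by case: (_ \in D); rewrite //= mulr0; case: eqP.
  case: (d \in D) => //=; have [->|//] := eqVneq s (c * d).
  by rewrite mulf_neq0.
rewrite nzE; apply/andP; split.
  by apply: leq_sum => c _; apply: leq_sum => d _; case: (s == _); rewrite //= leq_b1.
have [->|s0] := eqVneq s 0; last first.
  rewrite mul0n addn0; apply: leq_sum => c _; apply: leq_sum => d _.
  by rewrite andbT.
rewrite mul1n; apply: leq_trans (leq_addl _ _).
apply: leq_trans (_ : \sum_(c : F) \sum_(d : F) ((c == 0%R)%R + (d == 0%R)%R) <= _)%N.
  apply: leq_trans (_ : \sum_(c in C) \sum_(d : F) ((c == 0%R)%R + (d == 0%R)%R) <= _)%N.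
    apply: leq_sum => c _; rewrite [leqRHS](bigID (mem D)) /=.
    apply: leq_trans (leq_addr _ _); apply: leq_sum => d _.
    rewrite eq_sym mulf_eq0; by case: (c == 0); case: (d == 0).
  by rewrite [leqRHS](bigID (mem C)) /= leq_addr.
have sum_eq0 : (\sum_(c : F) (c == 0 :> F)%R = 1)%N.
  by rewrite (bigD1 0) //= eqxx big1 // => c /negPf ->.
under eq_bigr do rewrite big_split /= sum_eq0 sum_nat_const.
by rewrite big_split /= -big_distrr /= sum_eq0 sum_nat_const muln1 mul2n addnn.
Qed.

Lemma mul_count_le C D s : s != 0 -> (mul_count C D s <= #|F|)%N.
Proof.
move=> s0; apply: leq_trans (_ : \sum_(c : F) 1 <= _)%N; last by rewrite sum1_card.
rewrite /mul_count big_mkcond; apply: leq_sum => c _; case: (c \in C) => //.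
have [->|c0] := eqVneq c 0.
  by rewrite big1 // => d _; rewrite mul0r (negPf s0).
apply: leq_trans (_ : \sum_(d : F) (d == s / c)%R <= _)%N.
  rewrite [leqRHS](bigID (mem D)) /=; apply: leq_trans (leq_addr _ _).
  apply: leq_sum => d _; have [->|//] := eqVneq s (c * d).
  by rewrite mulrC mulKf ?eqxx.
by rewrite (bigD1 (s / c)) //= eqxx big1 // => d /negPf ->.
Qed.

Lemma countT_sum A B C D :
  countT A B C D = (\sum_(a in A) \sum_(b in B) mul_count C D (a + b)%R)%N.
Proof.
rewrite /countT -sum1dep_card /mul_count.
rewrite (reindex_onto (fun p : F * (F * (F * F)) => (p.1, p.2.1, p.2.2.1, p.2.2.2))
  (fun x => (x.1.1.1, (x.1.1.2, (x.1.2, x.2))))) /=; last by move=> [[[a b] c] d].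
under [RHS]eq_bigr do under eq_bigr do rewrite pair_big /=.
under [RHS]eq_bigr do rewrite pair_big /=.
rewrite pair_big /= big_mkcond [RHS]big_mkcond; apply: eq_bigr => -[a [b [c d]]] _ /=.
rewrite eqxx andbT.
by case: (a \in A); case: (b \in B); case: (c \in C); case: (d \in D); case: (_ == _).
Qed.

Lemma countN_sum A B C D lambda :
  countN A B C D lambda =
  (\sum_(a in A) \sum_(b in B) mul_count C D (lambda - a * b)%R)%N.
Proof.
rewrite /countN -sum1dep_card /mul_count.
rewrite (reindex_onto (fun p : F * (F * (F * F)) => (p.1, p.2.1, p.2.2.1, p.2.2.2))
  (fun x => (x.1.1.1, (x.1.1.2, (x.1.2, x.2))))) /=; last by move=> [[[a b] c] d].
under [RHS]eq_bigr do under eq_bigr do rewrite pair_big /=.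
under [RHS]eq_bigr do rewrite pair_big /=.
rewrite pair_big /= big_mkcond [RHS]big_mkcond; apply: eq_bigr => -[a [b [c d]]] _ /=.
rewrite eqxx andbT subr_eq [c * d + _]addrC [lambda == _]eq_sym.
by case: (a \in A); case: (b \in B); case: (c \in C); case: (d \in D); case: (_ == _).
Qed.

Lemma sum_opposite_pairs A B : (\sum_(a in A) \sum_(b in B) (a + b == 0)%R <= #|B|)%N.
Proof.
rewrite exchange_big -sum1_card; apply: leq_sum => b _ /=.
apply: leq_trans (_ : \sum_(a : F) (a == - b)%R <= _)%N.
  rewrite [leqRHS](bigID (mem A)) /=; apply: leq_trans (leq_addr _ _).
  by apply: leq_sum => a _; rewrite addr_eq0.
by rewrite (bigD1 (- b)) //= eqxx big1 // => a /negPf ->.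
Qed.

Lemma sum_inverse_pairs A B s : s != 0 ->
  (\sum_(a in A) \sum_(b in B) (s - a * b == 0)%R <= #|B|)%N.
Proof.
move=> s0; rewrite exchange_big -sum1_card; apply: leq_sum => b _ /=.
have [->|b0] := eqVneq b 0.
  by rewrite big1 // => a _; rewrite mulr0 subr0 (negPf s0).
apply: leq_trans (_ : \sum_(a : F) (a == s / b)%R <= _)%N.
  rewrite [leqRHS](bigID (mem A)) /=; apply: leq_trans (leq_addr _ _).
  apply: leq_sum => a _; rewrite subr_eq0; have [->|//] := eqVneq s (a * b).
  by rewrite mulfK ?eqxx.
by rewrite (bigD1 (s / b)) //= eqxx big1 // => a /negPf ->.
Qed.

Lemma countT_bounds A B C D :
  let cnt := (\sum_(a in A) \sum_(b in B) mul_count (C :\ 0%R) (D :\ 0%R) (a + b)%R)%N in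
  (cnt <= countT A B C D <= cnt + 2 * #|F| * #|B|)%N.
Proof.
rewrite /= countT_sum; apply/andP; split.
  apply: leq_sum => a _; apply: leq_sum => b _.
  by case/andP: (mul_count_nonzero C D (a + b)).
apply: leq_trans (_ : \sum_(a in A) \sum_(b in B)
   (mul_count (C :\ 0%R) (D :\ 0%R) (a + b)%R + (a + b == 0)%R * (2 * #|F|)) <= _)%N.
  apply: leq_sum => a _; apply: leq_sum => b _.
  by case/andP: (mul_count_nonzero C D (a + b)).
under eq_bigr do rewrite big_split -big_distrl /=.
rewrite big_split -big_distrl leq_add2l /= mulnC leq_mul2l.
by rewrite sum_opposite_pairs orbT.
Qed.

(* Dividing [lambda - a * b = c * d] by [b] brings it to the shape of the
   equation counted by [T], with a factor depending on [b]. *)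
Lemma countN_bounds A B C D lambda : lambda != 0 ->
  let A' := [set - a | a in A] in
  let B' := [set lambda / b | b in B :\ 0] in
  let cnt := (\sum_(a in A') \sum_(b in B')
     \sum_(c in C :\ 0%R) \sum_(d in D :\ 0%R) (a + b == b / lambda * (c * d))%R)%N in
  (cnt <= countN A B C D lambda <= cnt + (2 * #|F| * #|B| + #|F| * #|A|))%N.
Proof.
rewrite /= => l0; set cnt := (\sum_(a in [set _ | _ in _]) _)%N.
have cntE : cnt = (\sum_(a in A) \sum_(b in B :\ 0%R)
    mul_count (C :\ 0%R) (D :\ 0%R) (lambda - a * b)%R)%N.
  rewrite /cnt big_imset /=; last by move=> a a' _ _ /oppr_inj.
  apply: eq_bigr => a _; rewrite big_imset /=; last first.
    by move=> b b' _ _ /(mulfI l0) /invr_inj.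
  apply: eq_bigr => b; rewrite !inE => /andP[b0 _].
  apply: eq_bigr => c _; apply: eq_bigr => d _; congr nat_of_bool.
  rewrite -(inj_eq (mulfI b0)); congr (_ == _).
    by rewrite mulrDr mulrN [b * (lambda / b)]mulrC divfK // addrC [b * a]mulrC.
  by field; rewrite b0 l0.
rewrite cntE countN_sum; apply/andP; split.
  apply: leq_sum => a _; rewrite big_mkcond [leqRHS]big_mkcond; apply: leq_sum => b _.
  rewrite !inE; case: (b != 0) => //=; case: (b \in B) => //.
  by case/andP: (mul_count_nonzero C D (lambda - a * b)).
apply: leq_trans (_ : \sum_(a in A) (\sum_(b in B :\ 0%R) mul_count (C :\ 0%R) (D :\ 0%R) (lambda - a * b)%R
   + (\sum_(b in B) (lambda - a * b == 0)%R * (2 * #|F|) + #|F|)) <= _)%N.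
  apply: leq_sum => a _.
  apply: leq_trans (_ : \sum_(b in B) (mul_count (C :\ 0%R) (D :\ 0%R) (lambda - a * b)%R
    + (lambda - a * b == 0)%R * (2 * #|F|)) <= _)%N.
    apply: leq_sum => b _.
    by case/andP: (mul_count_nonzero C D (lambda - a * b)).
  rewrite big_split /= [X in (_ <= _ + X)%N]addnC addnA leq_add2r.
  (* For [b = 0], where division by [b] fails, the equation is [lambda = c * d]; it has at most
     [#|F|] solutions because [lambda != 0]. *)
  have [B0|B0] := boolP (0 \in B).
    rewrite (big_setD1 0) //= addnC leq_add2l mulr0 subr0.
    by apply: mul_count_le.
  have -> : B :\ 0 = B by apply/setDidPl; rewrite disjoint_sym disjoints1.
  exact: leq_addr.
rewrite big_split /= leq_add2l big_split /= leq_add //.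
  under eq_bigr do rewrite -big_distrl /=.
  by rewrite -big_distrl /= mulnC leq_mul2l sum_inverse_pairs ?orbT.
by rewrite sum_nat_const mulnC.
Qed.

Lemma sum_nonopposite_pairs A B :
  (#|A| * #|B| <= \sum_(a in A) \sum_(b in B) (a + b != 0)%R + #|B|)%N.
Proof.
apply: leq_trans (_ : (\sum_(a in A) \sum_(b in B) (a + b != 0)%R +
  \sum_(a in A) \sum_(b in B) (a + b == 0)%R) <= _)%N; last first.
  by rewrite leq_add2l sum_opposite_pairs.
rewrite -big_split /= (eq_bigr (fun=> #|B|)) ?sum_nat_const // => a _.
rewrite -big_split /= (eq_bigr (fun=> 1%N)) ?sum1_card // => b _.
by case: (_ == _).
Qed.

Lemma sum_nonopposite_pairs_le A B :
  (\sum_(a in A) \sum_(b in B) (a + b != 0)%R <= #|A| * #|B|)%N.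
Proof.
rewrite -sum_nat_const; apply: leq_sum => a _; rewrite -sum1_card.
by apply: leq_sum => b _; apply: leq_b1.
Qed.

End CountingSolutions.

(** * Asymptotics *)

(** Both inequalities are images of the same inequality between integers; this carries the estimate
    from [algC] to the real field. *)
Lemma natr_dist_exp_le (R S : numDomainType) (m n N k : nat) :
  `|m%:R - n%:R| ^+ k <= N%:R :> S -> `|m%:R - n%:R| ^+ k <= N%:R :> R.
Proof.
have castE (T : numDomainType) :
    (`|m%:R - n%:R| ^+ k <= N%:R :> T) = (`|m%:Z - n%:Z| ^+ k <= N%:Z).
  by rewrite -(ler_int T) rmorphXn /= intr_norm rmorphB.
by rewrite !castE.
Qed.

Section Asymptotics.

Variable R : realType.

(** Since [1 / 2 <= k%:R * e], one has [q <= b ^+ (2 * k)], so both summands are at most a constant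
    times [b ^+ (4 * k) * q]. The size of [a] saves [q]^ (2 * e)[, while the density of]g[costs]q
    [^ (2 * k%:R * d)]. By [3 * k%:R * d <= e] the net saving is at least [q]^ (4 * k%:R *
    d)[, the]4 * k[-th power of]q [^ d]. *)
Lemma error_exponent (q a b g E e d : R) (k : nat) :
  1 <= q -> (0 < k)%N -> 1 / 2 <= k%:R * e -> 3 * k%:R * d <= e -> 0 <= E ->
  q `^ (1 / 2 + e) <= a -> q `^ e <= b -> q `^ (2 - d) <= g ->
  E ^+ (4 * k) <= a ^+ (2 * (2 * k).-1) *
    (2 * ((k%:R ^+ (2 * k) * b ^+ k * q) ^+ 2 + (2 * k%:R * b ^+ (2 * k)) ^+ 2 * q)) *
    (q ^+ 2 * g) ^+ (2 * k) ->
  E <= 2 * (k%:R ^+ (4 * k) + 4 * k%:R ^+ 2) * (a * b * g) * q `^ (- d).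
Proof.
move=> q_ge1 k_gt0 ke kd E_ge0 a_ge b_ge g_ge E_le.
have q_gt0 : 0 < q by apply: lt_le_trans q_ge1.
have q_ge0 := ltW q_gt0; have q_neq0 : q != 0 by rewrite gt_eqF.
have pow_gt0 x : 0 < q `^ x by apply: powR_gt0.
have pow_ge0 x := ltW (pow_gt0 x).
have powD x y : q `^ (x + y) = q `^ x * q `^ y by rewrite powRD // q_neq0 implybT.
have powX x n : (q `^ x) ^+ n = q `^ (x * n%:R) by rewrite powRrM powR_mulrn.
have pow1 : q `^ 1 = q by rewrite powRr1.
have powle x y : x <= y -> q `^ x <= q `^ y by apply: ler_powR.
have a_gt0 : 0 < a := lt_le_trans (pow_gt0 _) a_ge.
have b_gt0 : 0 < b := lt_le_trans (pow_gt0 _) b_ge.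
have g_gt0 : 0 < g := lt_le_trans (pow_gt0 _) g_ge.
have a_ge0 := ltW a_gt0; have b_ge0 := ltW b_gt0; have g_ge0 := ltW g_gt0.
set L := 2 * _; set t := q `^ (- d).
have k_ge1 : 1 <= k%:R :> R by rewrite ler1n.
have L_ge1 : 1 <= L.
  rewrite /L; have : 1 <= k%:R ^+ (4 * k) :> R by apply: exprn_ege1.
  by have : 0 <= k%:R ^+ 2 :> R; [rewrite exprn_ge0 ?ler0n|lra].
have k4_gt0 : (0 < 4 * k)%N by rewrite muln_gt0.
have L_ge0 : 0 <= L by apply: le_trans L_ge1.
have rhs_ge0 : 0 <= L * (a * b * g) * t.
  apply: mulr_ge0; last exact: pow_ge0.
  by apply: mulr_ge0 => //; apply: mulr_ge0 => //; apply: mulr_ge0.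
rewrite -(ler_pXn2r k4_gt0) ?nnegrE //.
apply: le_trans E_le _.
have h1 : q <= b ^+ (2 * k).
  apply: le_trans (_ : (q `^ e) ^+ (2 * k) <= _); last by rewrite lerXn2r ?nnegrE.
  rewrite powX -{1}pow1; apply: powle; rewrite natrM; lra.
have h2 : q * q `^ (2 * e) <= a ^+ 2.
  apply: le_trans (_ : (q `^ (1 / 2 + e)) ^+ 2 <= _); last by rewrite lerXn2r ?nnegrE.
  by rewrite powX -{1}pow1 -powD; apply: powle; lra.
have h3 : q ^+ 2 <= g * q `^ d.
  apply: le_trans (_ : q `^ (2 - d) * q `^ d <= _); last by rewrite ler_wpM2r.
  by rewrite -powD subrK -powR_mulrn.
have step1 : 2 * ((k%:R ^+ (2 * k) * b ^+ k * q) ^+ 2 + (2 * k%:R * b ^+ (2 * k)) ^+ 2 * q)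
    <= L * (b ^+ (4 * k) * q).
  have -> : (k%:R ^+ (2 * k) * b ^+ k * q) ^+ 2 = k%:R ^+ (4 * k) * (b ^+ (2 * k) * q * q).
    rewrite !exprMn -!exprM (_ : 2 * k * 2 = 4 * k)%N; last by rewrite mulnC mulnA.
    by rewrite (mulnC k 2); ring.
  have -> : (2 * k%:R * b ^+ (2 * k)) ^+ 2 * q = 4 * k%:R ^+ 2 * (b ^+ (4 * k) * q).
    rewrite !exprMn -!exprM (_ : 2 * k * 2 = 4 * k)%N; last by rewrite mulnC mulnA.
    by ring.
  have -> : L * (b ^+ (4 * k) * q) =
      2 * (k%:R ^+ (4 * k) * (b ^+ (4 * k) * q) + 4 * k%:R ^+ 2 * (b ^+ (4 * k) * q)).
    by rewrite /L; ring.
  rewrite ler_wpM2l // lerD2r ler_wpM2l ?exprn_ge0 ?ler0n // ler_wpM2r //.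
  have -> : b ^+ (4 * k) = b ^+ (2 * k) * b ^+ (2 * k).
    by rewrite -exprD -mulnDl.
  by apply: ler_wpM2l; rewrite ?exprn_ge0.
have step2 : a ^+ (2 * (2 * k).-1) * q <= a ^+ (4 * k) * q `^ (- (2 * e)).
  have -> : a ^+ (4 * k) = a ^+ (2 * (2 * k).-1) * a ^+ 2.
    by rewrite -exprD; congr (_ ^+ _); clear -k_gt0; lia.
  rewrite -mulrA ler_wpM2l ?exprn_ge0 //.
  apply: le_trans (_ : (q * q `^ (2 * e)) * q `^ (- (2 * e)) <= _).
    by rewrite -mulrA -powD subrr powRr0 mulr1.
  by rewrite ler_wpM2r.
have step3 : (q ^+ 2 * g) ^+ (2 * k) <= g ^+ (4 * k) * q `^ (2 * k%:R * d).
  apply: le_trans (_ : (g * q `^ d * g) ^+ (2 * k) <= _).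
    by rewrite lerXn2r ?nnegrE ?mulr_ge0 ?exprn_ge0 // ler_wpM2r.
  rewrite mulrAC exprMn -expr2 -exprM mulnA powX natrM.
  by rewrite [d * _]mulrC.
have step4 : q `^ (- (2 * e)) * q `^ (2 * k%:R * d) <= t ^+ (4 * k).
  by rewrite -powD powX; apply: powle; rewrite natrM; lra.
(* As [1 <= L], the constant needs no root extraction. *)
have L_le : L <= L ^+ (4 * k) by rewrite -{1}[L]expr1 ler_weXn2l.
apply: le_trans (_ : a ^+ (2 * (2 * k).-1) * (L * (b ^+ (4 * k) * q)) *
    (g ^+ (4 * k) * q `^ (2 * k%:R * d)) <= _).
  rewrite ler_pM ?mulr_ge0 ?exprn_ge0 ?addr_ge0 ?mulr_ge0 ?exprn_ge0 ?ler0n //.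
  by rewrite ler_wpM2l ?exprn_ge0.
have -> : a ^+ (2 * (2 * k).-1) * (L * (b ^+ (4 * k) * q)) *
    (g ^+ (4 * k) * q `^ (2 * k%:R * d)) =
   L * b ^+ (4 * k) * g ^+ (4 * k) * (a ^+ (2 * (2 * k).-1) * q) * q `^ (2 * k%:R * d) by ring.
apply: le_trans (_ : L * b ^+ (4 * k) * g ^+ (4 * k) *
   (a ^+ (4 * k) * q `^ (- (2 * e))) * q `^ (2 * k%:R * d) <= _).
  rewrite ler_wpM2r // ler_wpM2l // mulr_ge0 ?exprn_ge0 //.
  by rewrite (mulr_ge0 L_ge0) ?exprn_ge0.
have -> : L * b ^+ (4 * k) * g ^+ (4 * k) *
   (a ^+ (4 * k) * q `^ (- (2 * e))) * q `^ (2 * k%:R * d) =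
   (L * (a * b * g) ^+ (4 * k)) * (q `^ (- (2 * e)) * q `^ (2 * k%:R * d)).
  by rewrite !exprMn; ring.
rewrite [leRHS]exprMn [in leRHS]exprMn.
have abg_ge0 : 0 <= (a * b * g) ^+ (4 * k) by rewrite exprn_ge0 ?mulr_ge0.
apply: ler_pM step4; [exact: mulr_ge0|exact: mulr_ge0|exact: ler_wpM2r].
Qed.

(** A term lacking one of the factors [a], [b], [c], [d] of [M] is at most [M * t]. Discarded zeros
    and opposite pairs cost 4 such terms, the excess of [X] over [cnt] costs 3, and [dev] costs [L].
    Passing from [q - 1] to [q] adds [X], at most [2 * (L + 8) * (M * t)]; the total [3 * L + 23] is
    rounded up. *)
Lemma main_term_error (q a b c d P c' d' cnt X L t : R) :
  2 <= q -> 0 < a -> 0 < b -> 0 < c -> 0 < d -> 0 <= L -> 0 < t -> t <= 1 ->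
  1 <= q * t -> 1 <= a * t -> 1 <= b * t -> 1 <= c * t -> 1 <= d * t ->
  q ^+ 2 <= a * (c * d) * t -> q ^+ 2 <= b * (c * d) * t ->
  a * b - a - b <= P -> P <= a * b -> 0 <= P ->
  c - 1 <= c' -> c' <= c -> 0 <= c' -> d - 1 <= d' -> d' <= d -> 0 <= d' ->
  `|(q - 1) * cnt - P * c' * d'| <= L * (a * b * (c * d)) * t ->
  0 <= cnt -> cnt <= X -> X <= cnt + 2 * q * b + q * a ->
  `|X - a * b * c * d / q| <= (3 * L + 30) * t * (a * b * c * d / q).
Proof.
move=> q2 a0 b0 c0 d0 L0 t0 t1 qt at1 bt1 ct1 dt1 qa qb Pge Ple P0 cge cle c'0 dge dle d'0.
rewrite (_ : a * b * (c * d) = a * b * c * d); last by ring.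
set M := a * b * c * d => dev cnt0 X_ge X_le.
have M0 : 0 < M by rewrite !mulr_gt0.
have q0 : 0 < q by lra.
have [a_ge0 [b_ge0 [c_ge0 d_ge0]]] := (ltW a0, (ltW b0, (ltW c0, ltW d0))).
have scale u v : 0 <= u -> 1 <= v * t -> u <= u * v * t.
  by move=> u0 vt; rewrite -mulrA ler_peMr.
have abd : a * b * d <= M * t.
  have -> : M = a * b * d * c by rewrite /M; ring.
  by apply: scale => //; rewrite !mulr_ge0.
have abc : a * b * c <= M * t by apply: scale => //; rewrite !mulr_ge0.
have acd : a * c * d <= M * t.
  have -> : M = a * c * d * b by rewrite /M; ring.
  by apply: scale => //; rewrite !mulr_ge0.
have bcd : b * c * d <= M * t.
  have -> : M = b * c * d * a by rewrite /M; ring.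
  by apply: scale => //; rewrite !mulr_ge0.
have Pcd_le : P * c' * d' <= M.
  by rewrite /M -!mulrA !(mulrA a b) ler_pM ?mulr_ge0 // ler_pM.
have Pcd_ge : M - 4 * (M * t) <= P * c' * d'.
  have cd_ge : c * d - c - d <= c' * d'.
    have : (c - c') * d <= d by rewrite ler_piMl //; lra.
    have : c' * (d - d') <= c.
      by apply: le_trans (_ : c' * 1 <= _); [rewrite ler_wpM2l //; lra|rewrite mulr1].
    lra.
  have cd_le : c' * d' <= c * d by rewrite ler_pM.
  have p1 : (a * b - P) * (c' * d') <= (a + b) * (c * d).
    by rewrite ler_pM ?mulr_ge0 //; lra.
  have p2 : a * b * (c * d - c - d) <= a * b * (c' * d').
    by rewrite ler_wpM2l // mulr_ge0.
  have -> : P * c' * d' = a * b * (c' * d') - (a * b - P) * (c' * d') by ring.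
  have ME : M = a * b * (c * d - c - d) + a * b * d + a * b * c by rewrite /M; ring.
  have abcdE : (a + b) * (c * d) = a * c * d + b * c * d by ring.
  rewrite abcdE in p1; move: ME abd abc acd bcd p1 p2.
  move: (M * t) (a * b * (c * d - c - d)) (a * b * d) (a * b * c) (a * c * d) (b * c * d).
  move: ((a * b - P) * (c' * d')) (a * b * (c' * d')) => *; lra.
have qqb : q * (q * b) <= M * t.
  have -> : q * (q * b) = b * q ^+ 2 by ring.
  have -> : M * t = b * (a * (c * d) * t) by rewrite /M; ring.
  exact: ler_wpM2l.
have qqa : q * (q * a) <= M * t.
  have -> : q * (q * a) = a * q ^+ 2 by ring.
  have -> : M * t = a * (b * (c * d) * t) by rewrite /M; ring.
  exact: ler_wpM2l.
have r_le : (q - 1) * (X - cnt) <= 3 * (M * t).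
  apply: le_trans (_ : q * (2 * (q * b) + q * a) <= _); last by lra.
  by rewrite ler_pM //; lra.
have r_ge : 0 <= (q - 1) * (X - cnt) by rewrite mulr_ge0; lra.
have /ler_normlP[dev1 dev2] := dev.
have LMt : L * M * t = L * (M * t) by ring.
have Mt0 : 0 < M * t by rewrite mulr_gt0.
have up : (q - 1) * X - M <= (L + 7) * (M * t) by lra.
have low : - ((L + 7) * (M * t)) <= (q - 1) * X - M by lra.
have X0 : 0 <= X by lra.
have X_small : X <= 2 * (L + 8) * (M * t).
  have Mt_le : M * t <= M by rewrite ler_piMr // ltW.
  have LMt_le : (L + 7) * (M * t) <= (L + 7) * M by rewrite ler_wpM2l //; lra.
  have qX : q * X <= 2 * (L + 8) * M.
    have : q * X <= 2 * ((q - 1) * X) by have : 0 <= (q - 2) * X; [rewrite mulr_ge0 //; lra|lra].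
    lra.
  apply: le_trans (scale X q X0 qt) _.
  rewrite [leRHS]mulrA; apply: ler_wpM2r; first exact: ltW.
  by rewrite mulrC.
have -> : X - M / q = (q * X - M) / q by field; rewrite gt_eqF.
rewrite normrM (gtr0_norm (x := q^-1)) ?invr_gt0 //.
have -> : (3 * L + 30) * t * (M / q) = ((3 * L + 30) * (M * t)) / q by ring.
apply: ler_wpM2r; first by rewrite invr_ge0 ltW.
rewrite ler_norml.
have LMt0 : 0 <= L * (M * t) by rewrite mulr_ge0 // ltW.
apply/andP; split; lra.
Qed.

End Asymptotics.

(** Common to both equations: [A'] and [B'] are the sets after the change of variables, and [B'] may
    be one element short because [b = 0] is dropped. *)
Lemma count_asymptotics (R : realType) (e delta : R) (k : nat) (F : finFieldType)
    (A B A' B' C D : {set F}) (mu : F -> F) (X : nat) :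
  let q : R := #|F|%:R in
  let main : R := #|A|%:R * #|B|%:R * #|C|%:R * #|D|%:R / q in
  let cnt := (\sum_(a in A') \sum_(b in B') \sum_(c in C :\ 0%R) \sum_(d in D :\ 0%R)
                 (a + b == mu b * (c * d))%R)%N in
  (0 < k)%N -> 1 / 2 <= k%:R * e -> 3 * k%:R * delta <= e -> 0 < delta -> delta <= 1 / 2 ->
  #|A'| = #|A| -> (#|B'| <= #|B| <= #|B'|.+1)%N -> (forall b, b \in B' -> mu b != 0) ->
  q `^ (1 / 2 + e) <= #|A|%:R -> q `^ e <= #|B|%:R ->
  q `^ (2 - delta) <= #|C|%:R * #|D|%:R ->
  (cnt <= X <= cnt + (2 * #|F| * #|B| + #|F| * #|A|))%N ->
  exists2 theta : R,
    `|theta| <= (3 * (2 * (k%:R ^+ (4 * k) + 4 * k%:R ^+ 2)) + 30) * q `^ (- delta) &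
    X%:R = main * (1 + theta).
Proof.
move=> q main cnt k_gt0 ke kd d_gt0 d_le cardA' /andP[B'_le B_le] mu_neq0 A_ge B_ge CD_ge /andP[X_ge X_le].
have q_gt1 : (1 < #|F|)%N := finNzRing_gt1 F.
have q_ge2 : 2 <= q by rewrite /q ler_nat.
have q_ge1 : 1 <= q by lra.
have q_gt0 : 0 < q by lra.
have q_ge0 := ltW q_gt0; have q_neq0 : q != 0 by rewrite gt_eqF.
have pow_gt0 x : 0 < q `^ x by apply: powR_gt0.
have pow_ge0 x := ltW (pow_gt0 x).
have powD x y : q `^ (x + y) = q `^ x * q `^ y by rewrite powRD // q_neq0 implybT.
have pow1 : q `^ 1 = q by rewrite powRr1.
have pow_ge1 x : 0 <= x -> 1 <= q `^ x by move=> x0; rewrite -(powRr0 q) ler_powR.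
have powle x y : x <= y -> q `^ x <= q `^ y by apply: ler_powR.
have k_ge1 : 1 <= k%:R :> R by rewrite ler1n.
have d2_le : 3 * delta <= e.
  apply: le_trans kd; rewrite -mulrA; apply: ler_wpM2l => //.
  by apply: ler_peMl => //; apply: ltW.
set t := q `^ (- delta); have t_gt0 : 0 < t := pow_gt0 _.
have t_ge0 := ltW t_gt0.
have t_le1 : t <= 1 by rewrite -(powRr0 q) ler_powR // oppr_le0 ltW.
set a : R := #|A|%:R in A_ge main *; set b : R := #|B|%:R in B_ge main *.
set c : R := #|C|%:R in CD_ge main *; set d : R := #|D|%:R in CD_ge main *.
have a_gt0 : 0 < a := lt_le_trans (pow_gt0 _) A_ge.
have b_gt0 : 0 < b := lt_le_trans (pow_gt0 _) B_ge.
have cd_gt0 : 0 < c * d := lt_le_trans (pow_gt0 _) CD_ge.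
have c_ge0 : 0 <= c by rewrite ler0n.
have d_ge0 : 0 <= d by rewrite ler0n.
have c_gt0 : 0 < c by rewrite lt_def c_ge0 andbT; apply: contraTneq cd_gt0 => ->; rewrite mul0r ltxx.
have d_gt0' : 0 < d by rewrite lt_def d_ge0 andbT; apply: contraTneq cd_gt0 => ->; rewrite mulr0 ltxx.
have c_leq : c <= q by rewrite ler_nat max_card.
have d_leq : d <= q by rewrite ler_nat max_card.
have powt_ge1 x y : delta <= x -> q `^ x <= y -> 1 <= y * t.
  move=> le_x le_y; apply: le_trans (_ : q `^ x * t <= _); last by rewrite ler_wpM2r.
  by rewrite -powD pow_ge1 //; lra.
(* Neither of [C], [D] has more than [q] elements, so each of them is dense by itself. *)
have dense_ge x y : 0 <= x -> y <= q -> q `^ (2 - delta) <= x * y -> q `^ (1 - delta) <= x.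
  move=> x0 y_le xy; rewrite -(ler_pM2r q_gt0) -{2}pow1 -powD.
  rewrite (_ : 1 - delta + 1 = 2 - delta); last by ring.
  by apply: le_trans xy _; rewrite ler_wpM2l.
have c_ge : q `^ (1 - delta) <= c by apply: dense_ge CD_ge.
have d_ge : q `^ (1 - delta) <= d by apply: dense_ge _ _ _ c_leq _; rewrite // mulrC.
have q2_le x y : 2 * delta <= x -> q `^ x <= y -> q ^+ 2 <= y * (c * d) * t.
  move=> le_x le_y; apply: le_trans (_ : q `^ x * q `^ (2 - delta) * t <= _).
    by rewrite -!powD -powR_mulrn // powle //; lra.
  by rewrite ler_wpM2r // ler_pM.
set L : R := 2 * (k%:R ^+ (4 * k) + 4 * k%:R ^+ 2).
have L_ge0 : 0 <= L.
  by rewrite mulr_ge0 // addr_ge0 ?mulr_ge0 // exprn_ge0 ?ler0n.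
set pairs := (\sum_(a in A') \sum_(b in B') (a + b != 0)%R)%N.
have cardD0 (S : {set F}) : (#|S :\ 0%R| <= #|S| <= #|S :\ 0%R|.+1)%N.
  by rewrite [#|S|](cardsD1 0 S) leq_addl -add1n leq_add2r leq_b1.
have [C0_le C_le] := andP (cardD0 C); have [D0_le D_le] := andP (cardD0 D).
have dev : `|(q - 1) * cnt%:R - pairs%:R * #|C :\ 0%R|%:R * #|D :\ 0%R|%:R| <=
    L * (a * b * (c * d)) * t.
  apply: (@error_exponent _ q a b (c * d) _ e delta k) => //.
  - rewrite /pairs.
    have notin0 (S : {set F}) : 0 \notin S :\ 0 by rewrite setD11.
    have := @count_deviation F A' B' (C :\ 0) (D :\ 0) mu k k_gt0 (notin0 C) (notin0 D) mu_neq0.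
    move/(@natr_dist_exp_le R); rewrite -/cnt -/pairs.
    have qE : #|F|.-1%:R = q - 1 by rewrite -subn1 natrB // ltnW.
    rewrite natrM qE [(_ * #|_|)%:R]natrM [(_ * #|_|)%:R]natrM => /le_trans; apply.
    rewrite cardA' /a /b /c /d /q -!(natrM, natrX, natrD) ler_nat.
    have B'X n : (#|B'| ^ n <= #|B| ^ n)%N by case: n => // n; rewrite leq_exp2r.
    have leX m1 m2 n : (m1 <= m2 -> m1 ^ n <= m2 ^ n)%N by case: n => // n le_m; rewrite leq_exp2r.
    apply: leq_mul; first (apply: leq_mul => //).
      rewrite leq_mul2l /= leq_add //.
        by apply: leX; rewrite leq_mul2r leq_mul2l B'X !orbT.
      by rewrite leq_mul2r; apply/orP; right; apply: leX; rewrite leq_mul2l B'X orbT.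
    by apply: (leX _ _ (2 * k)%N); apply: leq_mul; [rewrite leX // leq_pred|apply: leq_mul].
have bB' : b - 1 <= #|B'|%:R.
  by rewrite lerBlDr natr1 ler_nat.
have B'_leb : #|B'|%:R <= b by rewrite ler_nat.
have pairs_ge : a * b - a - b <= pairs%:R.
  have := sum_nonopposite_pairs A' B'; rewrite -/pairs cardA' -(ler_nat R) natrM natrD -/a.
  have : a * (b - 1) <= a * #|B'|%:R by rewrite ler_wpM2l // ltW.
  lra.
have pairs_le : pairs%:R <= a * b.
  rewrite -natrM ler_nat; apply: leq_trans (sum_nonopposite_pairs_le A' B') _.
  by rewrite cardA' leq_mul2l B'_le orbT.
have X_leR : X%:R <= cnt%:R + 2 * q * b + q * a.
  by rewrite -!(natrM, natrD) ler_nat addnA in X_le *.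
have err := @main_term_error R q a b c d pairs%:R #|C :\ 0|%:R #|D :\ 0|%:R cnt%:R X%:R L t.
have {}err : `|X%:R - main| <= (3 * L + 30) * t * main.
  apply: err => //; rewrite ?ler0n ?ler_nat // ?lerBlDr ?natr1 ?ler_nat //.
  - by apply: (powt_ge1 1); [lra|rewrite pow1].
  - by apply: powt_ge1 A_ge; lra.
  - by apply: powt_ge1 B_ge; lra.
  - by apply: powt_ge1 c_ge; lra.
  - by apply: powt_ge1 d_ge; lra.
  - by apply: q2_le A_ge; lra.
  - by apply: q2_le B_ge; lra.
have main_gt0 : 0 < main by rewrite divr_gt0 // !mulr_gt0.
exists (X%:R / main - 1); last by rewrite addrC subrK mulrC divfK // gt_eqF.
have -> : X%:R / main - 1 = (X%:R - main) / main by rewrite mulrBl divff // gt_eqF.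
by rewrite normrM (gtr0_norm (x := main^-1)) ?invr_gt0 // ler_pdivrMr.
Qed.

Theorem theorem1 (R : realType) (epsilon : R) (epsilon_gt0 : 0 < epsilon) :
  exists2 delta : R, 0 < delta &
  exists2 K : R, 0 < K &
  forall (F : finFieldType) (lambda : F) (A B C D : {set F}),
    let q : R := #|F|%:R in
    let main : R := #|A|%:R * #|B|%:R * #|C|%:R * #|D|%:R / q in
    lambda != 0 ->
    q `^ (1 / 2 + epsilon) <= #|A|%:R ->
    q `^ epsilon <= #|B|%:R ->
    q `^ (2 - delta) <= #|C|%:R * #|D|%:R ->
    (exists2 theta : R, `|theta| <= K * q `^ (- delta) &
       (countN A B C D lambda)%:R = main * (1 + theta)) /\
    (exists2 theta : R, `|theta| <= K * q `^ (- delta) &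
       (countT A B C D)%:R = main * (1 + theta)).
Proof.
(* This makes [#|B| ^ k] at least [q], more than the required square root of [q]; the successor
   makes [k] positive. *)
pose k := (Num.bound epsilon^-1).+1.
have k_gt0 : (0 < k)%N by [].
have kR_gt0 : 0 < k%:R :> R by rewrite ltr0n.
have ke : 1 / 2 <= k%:R * epsilon.
  apply: le_trans (_ : 1 <= _); first by lra.
  rewrite -ler_pdivrMr // div1r.
  have inv_ge0 : 0 <= epsilon^-1 by rewrite invr_ge0 ltW.
  apply: le_trans (ltW (archi_boundP inv_ge0)) _.
  by rewrite ler_nat.
pose delta := Num.min (epsilon / (3 * k%:R)) (1 / 2).
have delta_gt0 : 0 < delta.
  by rewrite lt_min divr_gt0 ?mulr_gt0 //=; lra.
have kd : 3 * k%:R * delta <= epsilon.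
  have k3_gt0 : 0 < 3 * k%:R :> R by rewrite mulr_gt0.
  by rewrite mulrC -ler_pdivlMr // ge_min lexx.
have delta_le : delta <= 1 / 2 by rewrite ge_min lexx orbT.
exists delta => //.
exists (3 * (2 * (k%:R ^+ (4 * k) + 4 * k%:R ^+ 2)) + 30).
  have k4_ge0 : 0 <= k%:R ^+ (4 * k) :> R by rewrite exprn_ge0.
  have k2_ge0 : 0 <= k%:R ^+ 2 :> R by rewrite exprn_ge0.
  by lra.
move=> F lambda A B C D q main l0 A_ge B_ge CD_ge; split.
  apply: (@count_asymptotics R epsilon delta k F A B [set - a | a in A]
    [set lambda / b | b in B :\ 0] C D (fun b => b / lambda)) => //.
  - by rewrite card_imset //; apply: oppr_inj.
  - rewrite card_imset; last by move=> b b' /(mulfI l0) /invr_inj.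
    by rewrite [#|B|](cardsD1 0 B) leq_addl -add1n leq_add2r leq_b1.
  - move=> b' /imsetP[b]; rewrite !inE => /andP[b0 _] ->.
    by rewrite !mulf_neq0 ?invr_eq0.
  - exact: countN_bounds.
apply: (@count_asymptotics R epsilon delta k F A B A B C D (fun=> 1)) => //.
- by rewrite leqnn leqnSn.
- by move=> b _; rewrite oner_neq0.
have /andP[T_ge T_le] := countT_bounds A B C D.
have cntE : (\sum_(a in A) \sum_(b in B) \sum_(c in C :\ 0%R) \sum_(d in D :\ 0%R)
      (a + b == 1 * (c * d))%R =
    \sum_(a in A) \sum_(b in B) mul_count (C :\ 0%R) (D :\ 0%R) (a + b)%R)%N.
  apply: eq_bigr => a _; apply: eq_bigr => b _; apply: eq_bigr => c _.
  by apply: eq_bigr => d _; rewrite mul1r.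
by rewrite /= cntE T_ge (leq_trans T_le) // leq_add2l leq_addr.
Qed.
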